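(* Let $\mathfrak p\ge 2$ and $\nu\ge1$ be integers, let $\omega\in\mathbb R^\nu$ be rationally independent (i.e. $n\cdot\omega=0$ with $n\in\mathbb Z^\nu$ implies $n=0$), and let $c:\mathbb Z^\nu\to\mathbb C$ satisfy $$|c(n)|\le \mathcal A^{\frac{1}{\mathfrak p-1}}e^{-\kappa|n|}\quad\text{for all }n\in\mathbb Z^\nu,$$ for some constants $\mathcal A>0$ and $0<\kappa\le1$. Put $u_0(x)=\sum_{n\in\mathbb Z^\nu}c(n)e^{{\rm i}(n\cdot\omega)x}$, $\Box=2(6\kappa^{-1})^{\nu}\mathcal A^{\frac{1}{\mathfrak p-1}}$ and $$t_0=\min\left\{\frac{\kappa^{(\mathfrak p-1)\nu+1}}{2^{\mathfrak p+1}6^{(\mathfrak p-1)\nu+1}\mathcal A|\omega|},\ \frac{\kappa^{(\mathfrak p-1)\nu+1}}{2(\mathfrak p-1)e\,\Box^{\mathfrak p-1}12^{(\mathfrak p-1)\nu+1}|\omega|}\right\}>0 .$$ Then there exist coefficients $c^\dagger:[0,t_0)\times\mathbb Z^\nu\to\mathbb C$ with $$|c^\dagger(t,n)|\le \Box e^{-\frac{\kappa}{2}|n|}\quad\text{for all }0\le t<t_0,\ n\in\mathbb Z^\nu,$$ satisfying, for all $0\le t<t_0$ and $n\in\mathbb Z^\nu$, $$c^\dagger(t,n)=e^{{\rm i}(n\cdot\omega)^3t}c(n)-\frac{{\rm i}\,n\cdot\omega}{\mathfrak p}\int_0^t e^{{\rm i}(n\cdot\omega)^3(t-\tau)}\sum_{\substack{n_1,\dots,n_{\mathfrak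 p}\in\mathbb Z^\nu\\ n_1+\dots+n_{\mathfrak p}=n}}\prod_{j=1}^{\mathfrak p}c^\dagger(\tau,n_j)\,{\rm d}\tau,$$ and such that the spatially $\omega$-quasi-periodic function $u^\dagger(t,x)=\sum_{n\in\mathbb Z^\nu}c^\dagger(t,n)e^{{\rm i}(n\cdot\omega)x}$ ($0\le t<t_0$, $x\in\mathbb R$) is a classical solution of the generalized KdV equation $$\partial_tu+\partial_x^3u+u^{\mathfrak p-1}\partial_xu=0$$ on $[0,t_0)\times\mathbb R$ with $u^\dagger(0,x)=u_0(x)$. Moreover $c^\dagger(t,n)=\lim_{k\to\infty}c_k(t,n)$, where $c_k$ are the Picard iterates defined in the context.
   Context: Notation: for $n=(n^1,\dots,n^\nu)\in\mathbb Z^\nu$, $|n|=\sum_{i=1}^\nu|n^i|$ (the $\ell^1$ norm); $|\omega|$ is the Euclidean norm of $\omega\in\mathbb R^\nu$. Picard iterates: $c_0(t,n)=e^{{\rm i}(n\cdot\omega)^3t}c(n)$ and, for $k\ge1$, $$c_k(t,n)=c_0(t,n)-\frac{{\rm i}\,n\cdot\omega}{\mathfrak p}\int_0^t e^{{\rm i}(n\cdot\omega)^3(t-\tau)}\sum_{\substack{n_1,\dots,n_{\mathfrak p}\in\mathbb Z^\nu\\ n_1+\dots+n_{\mathfrak p}=n}}\prod_{j=1}^{\mathfrak p}c_{k-1}(\tau,n_j)\,{\rm d}\tau .$$ *)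

(* Defs.v *)
From Stdlib Require Import Reals ZArith List.
From Coquelicot Require Export Coquelicot.
Import ListNotations.
Open Scope R_scope.

(* Elements of Z^nu are represented by lists of integers of length nu;
   frequency vectors omega in R^nu by lists of reals of length nu. *)

Fixpoint zdot (n : list Z) (w : list R) : R :=
  match n, w with
  | z :: n', a :: w' => IZR z * a + zdot n' w'
  | _, _ => 0
  end.

Fixpoint zl1 (n : list Z) : R :=
  match n with
  | z :: n' => Rabs (IZR z) + zl1 n'
  | [] => 0
  end.

Definition rnorm (w : list R) : R := sqrt (fold_right (fun a s => a * a + s) 0 w).

Fixpoint vadd (x y : list Z) : list Z :=
  match x, y with
  | a :: x', b :: y' => (a + b)%Z :: vadd x' y'
  | _, _ => []
  end.
Fixpoint vsub (x y : list Z) : list Z :=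
  match x, y with
  | a :: x', b :: y' => (a - b)%Z :: vsub x' y'
  | _, _ => []
  end.
Definition vsum (nu : nat) (ts : list (list Z)) : list Z :=
  fold_right vadd (repeat 0%Z nu) ts.

Definition cexp (theta : R) : C := (cos theta, sin theta).

Fixpoint Cpow (z : C) (k : nat) : C :=
  match k with O => 1%C | S k => Cmult z (Cpow z k) end.

Definition lsum (l : list C) : C := fold_right Cplus 0%C l.

(* limit of a complex sequence (componentwise Lim_seq; the true limit
   whenever the sequence converges) *)
Definition Clim (s : nat -> C) : C :=
  (real (Lim_seq (fun N => fst (s N))), real (Lim_seq (fun N => snd (s N)))).

Definition zrange (N : nat) : list Z :=
  map (fun k => (Z.of_nat k - Z.of_nat N)%Z) (seq 0 (2 * N + 1)).

Fixpoint box (N k : nat) : list (list Z) :=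
  match k with
  | O => [[]]
  | S k => flat_map (fun v => map (fun z => z :: v) (zrange N)) (box N k)
  end.

Fixpoint tuples (N nu m : nat) : list (list (list Z)) :=
  match m with
  | O => [[]]
  | S m => flat_map (fun ts => map (fun v => v :: ts) (box N nu)) (tuples N nu m)
  end.

Definition zsum (nu : nat) (F : list Z -> C) : C :=
  Clim (fun N => lsum (map F (box N nu))).

(* sum_{n_1+...+n_p = n} prod_{j=1}^p a(n_j): parametrised by the free
   variables (n_1,...,n_{p-1}) in (Z^nu)^(p-1), n_p = n - n_1 - ... - n_{p-1},
   as the limit of sums over the exhausting boxes ([-N,N]^nu)^(p-1) *)
Definition conv (p nu : nat) (a : list Z -> C) (n : list Z) : C :=
  Clim (fun N => lsum (map (fun ts =>
          Cmult (fold_right Cmult 1%C (map a ts)) (a (vsub n (vsum nu ts))))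
        (tuples N nu (p - 1)))).

Fixpoint picard (p nu : nat) (w : list R) (c : list Z -> C) (k : nat)
    (t : R) (n : list Z) : C :=
  match k with
  | O => Cmult (cexp ((zdot n w) ^ 3 * t)) (c n)
  | S k =>
      Cminus (Cmult (cexp ((zdot n w) ^ 3 * t)) (c n))
        (Cmult (Cmult Ci (RtoC (zdot n w / INR p)))
           (@RInt C_R_CompleteNormedModule (fun tau => Cmult (cexp ((zdot n w) ^ 3 * (t - tau)))
                   (conv p nu (fun m => picard p nu w c k tau m) n)) 0 t))
  end.

Definition rat_indep (nu : nat) (w : list R) : Prop :=
  forall n : list Z, length n = nu -> zdot n w = 0 -> List.Forall (fun z => z = 0%Z) n.

Definition Ico0 (t0 t : R) : Prop := 0 <= t < t0.

Definition cont_on_strip (t0 : R) (f : R -> R -> C) (t x : R) : Prop :=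
  filterlim (fun q : (R * R)%type => f (fst q) (snd q))
    (within (fun q : (R * R)%type => Ico0 t0 (fst q)) (locally (t, x)))
    (locally (f t x)).

(* time derivative at t relative to [0,t0) (one-sided at t = 0) *)
Definition tderiv_on (t0 : R) (u : R -> R -> C) (t x : R) (l : C) : Prop :=
  filterlim (fun s => scal (/ (s - t)) (minus (u s x) (u t x)))
    (within (fun s => Ico0 t0 s /\ s <> t) (locally t)) (locally l).

Definition gKdV_classical (p : nat) (t0 : R) (u : R -> R -> C) : Prop :=
  exists ut ux uxx uxxx : R -> R -> C,
    forall t x, Ico0 t0 t ->
      tderiv_on t0 u t x (ut t x) /\
      is_derive (fun y => u t y) x (ux t x) /\
      is_derive (fun y => ux t y) x (uxx t x) /\
      is_derive (fun y => uxx t y) x (uxxx t x) /\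
      cont_on_strip t0 u t x /\ cont_on_strip t0 ut t x /\
      cont_on_strip t0 ux t x /\ cont_on_strip t0 uxx t x /\
      cont_on_strip t0 uxxx t x /\
      Cplus (Cplus (ut t x) (uxxx t x)) (Cmult (Cpow (u t x) (p - 1)) (ux t x)) = 0%C.

(* Main.v *)
Require Import Defs.
From Stdlib Require Import Reals ZArith List Lra Lia Permutation.
From Coquelicot Require Import Coquelicot.
Import ListNotations.
Open Scope R_scope.

(** Measure coefficients at time [t] in the weighted norm with weight [exp ((y0 - s t) |n|)].
    Because the weight shrinks at the constant rate [s], the factor [|n . omega|] of the Duhamel
    term is absorbed by the time integral, as [int_0^t s |n| exp (- s |n| (t - tau)) dtau <= 1],
    and no power of [|n|] is lost.  The Picard iterates and their increments are then dominated,
    uniformly in time, by the iterates of the scalar majorant recursion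
    [b_{k+1} = b_0 + lam * b_k^{*p}] on summable sequences: these increase, and for
    [y0 = 3 kappa / 5], [s = |omega| Box^(p-1)], [lam = 1 / (p Box^(p-1))] their sums stay below
    [Box], while [y0 - s t >= kappa / 2] up to time [t0].  So the iterates converge to a fixed
    point with exponentially decaying coefficients, whose Fourier series may be differentiated
    termwise; the nonlinear term is identified by differentiating
    [u^p = sum_n c^{*p}(n) exp (i (n . omega) x)]. *)

(** No contraction estimate is made, because the constants leave no room for one. On sums the
    majorant recursion acts as $S\mapsto \Box/2+\lambda S^{\mathfrak p}$, and its derivative at
    $S=\Box$ is $\mathfrak p\lambda\Box^{\mathfrak p-1}=1$; for $\mathfrak p=2$ the value $\Box$ is
    even a double fixed point. Convergence comes from monotonicity instead. A difference of two
    products is bounded by the difference of the products of their majorants, without any constant,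
    because both telescope in the same way. Convolution, the time integral and the Picard map
    preserve such bounds. Differences of iterates are therefore controlled by differences of a
    bounded increasing real sequence. For this reason most estimates concern two pairs [a], [b] and
    [a'], [b'] at once, and the bound for a single sequence is the case where the second pair is
    zero.

    The parameters $\lambda$ and $s$ are tied by $|\omega|\le\mathfrak p\lambda s$: a small
    nonlinear coefficient must be paid for by a fast loss of decay, and the length of the time
    interval limits that loss. *)

Lemma exp_le_compat (x y : R) : x <= y -> exp x <= exp y.
Proof. intros [H|H]; [apply Rlt_le, exp_increasing, H | rewrite H; lra]. Qed.

(** * Limits of complex-valued functions along a filter *)

(** Convergence measured by the modulus rather than by the componentwise balls of the product
    structure on [C], so that the triangle inequality and multiplicativity apply directly. *)
Definition Ctends {T : Type} (F : (T -> Prop) -> Prop) (f : T -> C) (z : C) : Prop :=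
  forall eps : R, 0 < eps -> F (fun x => Cmod (f x - z) < eps).

Lemma Cmod_minus_sym (a b : C) : Cmod (a - b) = Cmod (b - a).
Proof. rewrite <- Cmod_opp. f_equal. ring. Qed.

Lemma Cmod_fst_le (z : C) : Rabs (fst z) <= Cmod z.
Proof. eapply Rle_trans; [apply Rmax_l | apply Rmax_Cmod]. Qed.

Lemma Cmod_snd_le (z : C) : Rabs (snd z) <= Cmod z.
Proof. eapply Rle_trans; [apply Rmax_r | apply Rmax_Cmod]. Qed.

Lemma Cmod_le_fst_snd (z : C) : Cmod z <= Rabs (fst z) + Rabs (snd z).
Proof.
  replace z with (RtoC (fst z) + Ci * RtoC (snd z))%C
    by (destruct z; unfold RtoC, Ci, Cplus, Cmult; simpl; f_equal; ring).
  eapply Rle_trans; [apply Cmod_triangle|].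
  rewrite Cmod_mult, Cmod_Ci, !Cmod_R, Rmult_1_l.
  unfold RtoC, Ci, Cplus, Cmult; simpl.
  apply Req_le; f_equal; f_equal; ring.
Qed.

(** The modulus lies between the absolute value of either component and the sum of both, so the two
    kinds of neighbourhood generate the same filter. *)
Lemma Ctends_filterlim {T : Type} (F : (T -> Prop) -> Prop) {FF : Filter F}
    (f : T -> C) (z : C) :
  filterlim f F (locally z) <-> Ctends F f z.
Proof.
  split.
  - intros H eps Heps.
    assert (Hh : 0 < eps / 2) by lra.
    apply (H (fun y => Cmod (y - z) < eps)). exists (mkposreal _ Hh). intros y [H1 H2].
    apply Rle_lt_trans with (1 := Cmod_le_fst_snd _).
    change (Rabs (fst y - fst z) < eps / 2) in H1.
    change (Rabs (snd y - snd z) < eps / 2) in H2.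
    change (Rabs (fst y - fst z) + Rabs (snd y - snd z) < eps). lra.
  - intros H P [eps HP].
    unfold filtermap.
    generalize (H eps (cond_pos eps)). apply filter_imp.
    intros x Hx. apply HP. split.
    + change (Rabs (fst (f x - z)%C) < eps).
      eapply Rle_lt_trans; [apply Cmod_fst_le | exact Hx].
    + change (Rabs (snd (f x - z)%C) < eps).
      eapply Rle_lt_trans; [apply Cmod_snd_le | exact Hx].
Qed.

Section CtendsFacts.
Context {T : Type} {F : (T -> Prop) -> Prop}.

Lemma Ctends_const {FF : Filter F} (z : C) : Ctends F (fun _ => z) z.
Proof.
  intros eps He. apply filter_forall. intros _.
  replace (z - z)%C with (RtoC 0) by ring. rewrite Cmod_0. exact He.
Qed.

Lemma Ctends_ext_loc {FF : Filter F} (f g : T -> C) (z : C) :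
  F (fun x => f x = g x) -> Ctends F f z -> Ctends F g z.
Proof.
  intros H1 H2 eps He.
  generalize (filter_and _ _ H1 (H2 eps He)). apply filter_imp.
  intros x [E H]. rewrite <- E. exact H.
Qed.

Lemma Ctends_ext {FF : Filter F} (f g : T -> C) (z : C) :
  (forall x, f x = g x) -> Ctends F f z -> Ctends F g z.
Proof. intros H. apply Ctends_ext_loc. apply filter_forall. exact H. Qed.

Lemma Ctends_plus {FF : Filter F} (f g : T -> C) (a b : C) :
  Ctends F f a -> Ctends F g b -> Ctends F (fun x => f x + g x)%C (a + b)%C.
Proof.
  intros H1 H2 eps He.
  assert (Hh : 0 < eps / 2) by lra.
  generalize (filter_and _ _ (H1 _ Hh) (H2 _ Hh)). apply filter_imp.
  intros x [A B].
  replace (f x + g x - (a + b))%C with ((f x - a) + (g x - b))%C by ring.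
  eapply Rle_lt_trans; [apply Cmod_triangle|lra].
Qed.

Lemma Ctends_mult {FF : Filter F} (f g : T -> C) (a b : C) :
  Ctends F f a -> Ctends F g b -> Ctends F (fun x => f x * g x)%C (a * b)%C.
Proof.
  intros H1 H2 eps He.
  pose proof (Cmod_ge_0 a) as Ha. pose proof (Cmod_ge_0 b) as Hb.
  (* As [d <= 1], the three terms of the expansion below add up to at most
     [d * (1 + Cmod a + Cmod b)]; the extra [d] in [Cmod a + Cmod b + 2] makes the inequality
     strict. *)
  set (d := Rmin 1 (eps / (Cmod a + Cmod b + 2))).
  assert (Hd : 0 < d).
  { apply Rmin_pos; [lra|]. apply Rdiv_lt_0_compat; lra. }
  assert (Hd1 : d <= 1) by apply Rmin_l.
  assert (Hd2 : d * (Cmod a + Cmod b + 2) <= eps).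
  { apply Rle_trans with (eps / (Cmod a + Cmod b + 2) * (Cmod a + Cmod b + 2)).
    - apply Rmult_le_compat_r; [lra | apply Rmin_r].
    - right. field. lra. }
  generalize (filter_and _ _ (H1 _ Hd) (H2 _ Hd)). apply filter_imp.
  intros x [A B].
  replace (f x * g x - a * b)%C
    with ((f x - a) * (g x - b) + (f x - a) * b + a * (g x - b))%C by ring.
  eapply Rle_lt_trans; [apply Cmod_triangle|].
  eapply Rle_lt_trans; [apply Rplus_le_compat_r; apply Cmod_triangle|].
  rewrite !Cmod_mult.
  pose proof (Cmod_ge_0 (f x - a)). pose proof (Cmod_ge_0 (g x - b)).
  assert (Cmod (f x - a) * Cmod (g x - b) <= d * 1) by (apply Rmult_le_compat; lra).
  assert (Cmod (f x - a) * Cmod b <= d * Cmod b) by (apply Rmult_le_compat_r; lra).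
  assert (Cmod a * Cmod (g x - b) <= d * Cmod a)
    by (rewrite Rmult_comm; apply Rmult_le_compat_r; lra).
  nra.
Qed.

Lemma Ctends_scal {FF : Filter F} (k : C) (f : T -> C) (a : C) :
  Ctends F f a -> Ctends F (fun x => k * f x)%C (k * a)%C.
Proof. apply Ctends_mult. apply Ctends_const. Qed.

Lemma Ctends_opp {FF : Filter F} (f : T -> C) (a : C) :
  Ctends F f a -> Ctends F (fun x => - f x)%C (- a)%C.
Proof.
  intros H eps He. generalize (H eps He). apply filter_imp. intros x Hx.
  replace (- f x - - a)%C with (- (f x - a))%C by ring. rewrite Cmod_opp. exact Hx.
Qed.

Lemma Ctends_minus {FF : Filter F} (f g : T -> C) (a b : C) :
  Ctends F f a -> Ctends F g b -> Ctends F (fun x => f x - g x)%C (a - b)%C.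
Proof. intros H1 H2. apply Ctends_plus; [exact H1 | apply Ctends_opp; exact H2]. Qed.

Lemma Ctends_le {FF : ProperFilter F} (f : T -> C) (a : C) (M : R) :
  Ctends F f a -> F (fun x => Cmod (f x) <= M) -> Cmod a <= M.
Proof.
  intros H1 H2. apply Rnot_lt_le. intros Hlt.
  assert (He : 0 < Cmod a - M) by lra.
  destruct (filter_ex _ (filter_and _ _ H2 (H1 _ He))) as [x [A B]].
  assert (Cmod a <= Cmod (f x) + Cmod (f x - a)).
  { replace a with (f x + - (f x - a))%C at 1 by ring.
    eapply Rle_trans; [apply Cmod_triangle|]. rewrite Cmod_opp. lra. }
  lra.
Qed.

Lemma Ctends_unique {FF : ProperFilter F} (f : T -> C) (a b : C) :
  Ctends F f a -> Ctends F f b -> a = b.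
Proof.
  intros H1 H2.
  assert (H : Cmod (a - b) <= 0).
  { apply Ctends_le with (f := fun x => (f x - f x)%C).
    - apply Ctends_minus; assumption.
    - apply filter_forall. intros x. replace (f x - f x)%C with (RtoC 0) by ring.
      rewrite Cmod_0. lra. }
  assert (H0 : Cmod (a - b) = 0) by (pose proof (Cmod_ge_0 (a - b)); lra).
  apply Cmod_eq_0 in H0.
  replace a with (a - b + b)%C by ring. rewrite H0. ring.
Qed.

Lemma Ctends_squeeze {FF : Filter F} (f : T -> C) (a : C) (g : T -> R) :
  F (fun x => Cmod (f x - a) <= g x) -> filterlim g F (locally 0) -> Ctends F f a.
Proof.
  intros H1 H2 eps He.
  assert (H3 : F (fun x => Rabs (g x - 0) < eps)).
  { apply (H2 (fun y => Rabs (y - 0) < eps)). exists (mkposreal _ He). intros y Hy. exact Hy. }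
  generalize (filter_and _ _ H1 H3). apply filter_imp.
  intros x [A B]. rewrite Rminus_0_r in B.
  apply Rle_lt_trans with (1 := A). apply Rle_lt_trans with (2 := B). apply Rle_abs.
Qed.

Lemma Ctends_fst {FF : Filter F} (f : T -> C) (a : C) :
  Ctends F f a -> filterlim (fun x => fst (f x)) F (locally (fst a)).
Proof.
  intros H P [eps HP]. unfold filtermap.
  generalize (H eps (cond_pos eps)). apply filter_imp.
  intros x Hx. apply HP. change (Rabs (fst (f x - a)%C) < eps).
  eapply Rle_lt_trans; [apply Cmod_fst_le | exact Hx].
Qed.

Lemma Ctends_RtoC {FF : Filter F} (f : T -> R) (a : R) :
  filterlim f F (locally a) -> Ctends F (fun x => RtoC (f x)) (RtoC a).
Proof.
  intros H eps He. 
  assert (H3 : F (fun x => Rabs (f x - a) < eps)).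
  { apply (H (fun y => Rabs (y - a) < eps)). exists (mkposreal _ He). intros y Hy. exact Hy. }
  generalize H3. apply filter_imp. intros x Hx.
  rewrite <- RtoC_minus, Cmod_R. exact Hx.
Qed.

End CtendsFacts.

Lemma Ctends_comp {T U : Type} (F : (T -> Prop) -> Prop) (G : (U -> Prop) -> Prop)
    (h : T -> U) (f : U -> C) (a : C) :
  filterlim h F G -> Ctends G f a -> Ctends F (fun x => f (h x)) a.
Proof. intros H1 H2 eps He. apply (H1 _ (H2 eps He)). Qed.

Lemma Ctends_filter_le {T : Type} (F G : (T -> Prop) -> Prop) (f : T -> C) (a : C) :
  filter_le F G -> Ctends G f a -> Ctends F f a.
Proof. intros H1 H2 eps He. apply H1. apply H2. exact He. Qed.

Lemma Clim_correct (s : nat -> C) (z : C) : Ctends eventually s z -> Clim s = z.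
Proof.
  intros H. apply Ctends_filterlim in H; [|apply eventually_filter].
  destruct z as [a b]. unfold Clim. f_equal.
  - replace a with (real (Finite a)) by reflexivity. f_equal.
    apply is_lim_seq_unique.
    apply (filterlim_comp _ _ _ s fst _ _ _ H). intros P [eps HP]. exists eps.
    intros y [Hy _]. apply HP. exact Hy.
  - replace b with (real (Finite b)) by reflexivity. f_equal.
    apply is_lim_seq_unique.
    apply (filterlim_comp _ _ _ s snd _ _ _ H). intros P [eps HP]. exists eps.
    intros y [_ Hy]. apply HP. exact Hy.
Qed.

(** [Clim] is total and may return a meaningless value. Completeness of [C] provides a limit, and
    [Clim] must then be that limit. *)
Lemma Clim_cauchy (s : nat -> C) :
  (forall eps, 0 < eps -> exists N, forall m, (N <= m)%nat -> Cmod (s m - s N) < eps) ->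
  Ctends eventually s (Clim s).
Proof.
  intros H.
  assert (Hc : exists z : C, filterlim s eventually (locally z)).
  { apply (proj1 (filterlim_locally_cauchy (U := C_R_CompleteNormedModule) (F := eventually) s)).
    intros eps. assert (Hh : 0 < eps / 2) by (generalize (cond_pos eps); lra).
    destruct (H _ Hh) as [N HN].
    exists (fun n => (N <= n)%nat). split.
    - exists N. auto.
    - intros u v Hu Hv.
      assert (Hd : Cmod (s v - s u) < eps).
      { replace (s v - s u)%C with ((s v - s N) + - (s u - s N))%C by ring.
        eapply Rle_lt_trans; [apply Cmod_triangle|]. rewrite Cmod_opp.
        pose proof (HN _ Hu). pose proof (HN _ Hv). lra. }
      split.
      + change (Rabs (fst (s v - s u)%C) < eps).
        eapply Rle_lt_trans; [apply Cmod_fst_le | exact Hd].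
      + change (Rabs (snd (s v - s u)%C) < eps).
        eapply Rle_lt_trans; [apply Cmod_snd_le | exact Hd]. }
  destruct Hc as [z Hz]. apply (Ctends_filterlim eventually) in Hz.
  rewrite (Clim_correct _ _ Hz). exact Hz.
Qed.

(** * Sums over exhausting sequences of finite lists *)

Definition rsum {X : Type} (g : X -> R) (l : list X) : R :=
  fold_right (fun x s => g x + s) 0 l.

Definition csum {X : Type} (f : X -> C) (l : list X) : C := lsum (map f l).

Section FiniteSums.
Context {X : Type}.
Implicit Types (f g : X -> C) (u v : X -> R) (l : list X).

Lemma csum_app f l l' : csum f (l ++ l') = (csum f l + csum f l')%C.
Proof.
  unfold csum, lsum. induction l as [|x l IH]; simpl; [ring|]. rewrite IH. ring.
Qed.

Lemma rsum_app u l l' : rsum u (l ++ l') = rsum u l + rsum u l'.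
Proof. unfold rsum. induction l as [|x l IH]; simpl; [ring|]. rewrite IH. ring. Qed.

Lemma csum_perm f l l' : Permutation l l' -> csum f l = csum f l'.
Proof.
  unfold csum, lsum. induction 1; simpl; [reflexivity| | | congruence].
  - rewrite IHPermutation. reflexivity.
  - ring.
Qed.

Lemma rsum_perm u l l' : Permutation l l' -> rsum u l = rsum u l'.
Proof.
  unfold rsum. induction 1; simpl; [reflexivity| | | congruence].
  - rewrite IHPermutation. reflexivity.
  - ring.
Qed.

Lemma csum_ext f g l : (forall x, In x l -> f x = g x) -> csum f l = csum g l.
Proof. intros H. unfold csum. f_equal. apply map_ext_in. exact H. Qed.

Lemma csum_scal (k : C) f l : csum (fun x => k * f x)%C l = (k * csum f l)%C.
Proof. unfold csum, lsum. induction l as [|x l IH]; simpl; [ring|]. rewrite IH. ring. Qed.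

Lemma csum_plus f g l : csum (fun x => f x + g x)%C l = (csum f l + csum g l)%C.
Proof. unfold csum, lsum. induction l as [|x l IH]; simpl; [ring|]. rewrite IH. ring. Qed.

Lemma csum_minus f g l : csum (fun x => f x - g x)%C l = (csum f l - csum g l)%C.
Proof. unfold csum, lsum. induction l as [|x l IH]; simpl; [ring|]. rewrite IH. ring. Qed.

Lemma csum_RtoC u l : csum (fun x => RtoC (u x)) l = RtoC (rsum u l).
Proof.
  unfold csum, lsum, rsum. induction l as [|x l IH]; simpl; [reflexivity|].
  rewrite IH, RtoC_plus. reflexivity.
Qed.

Lemma rsum_scal (k : R) u l : rsum (fun x => k * u x) l = k * rsum u l.
Proof. unfold rsum. induction l as [|x l IH]; simpl; [ring|]. rewrite IH. ring. Qed.

Lemma rsum_plus u v l : rsum (fun x => u x + v x) l = rsum u l + rsum v l.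
Proof. unfold rsum. induction l as [|x l IH]; simpl; [ring|]. rewrite IH. ring. Qed.

Lemma rsum_minus u v l : rsum (fun x => u x - v x) l = rsum u l - rsum v l.
Proof. unfold rsum. induction l as [|x l IH]; simpl; [ring|]. rewrite IH. ring. Qed.

Lemma rsum_le u v l : (forall x, In x l -> u x <= v x) -> rsum u l <= rsum v l.
Proof.
  unfold rsum. induction l as [|x l IH]; simpl; intros H; [lra|].
  apply Rplus_le_compat; [apply H; auto | apply IH; intros; apply H; auto].
Qed.

Lemma rsum_ext u v l : (forall x, In x l -> u x = v x) -> rsum u l = rsum v l.
Proof. intros H. apply Rle_antisym; apply rsum_le; intros x Hx; rewrite (H x Hx); lra. Qed.

Lemma rsum_ge0 u l : (forall x, In x l -> 0 <= u x) -> 0 <= rsum u l.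
Proof.
  unfold rsum. induction l as [|x l IH]; simpl; intros H; [lra|].
  apply Rplus_le_le_0_compat; [apply H; auto | apply IH; intros; apply H; auto].
Qed.

Lemma rsum_ge_elem u l x : (forall x, In x l -> 0 <= u x) -> In x l -> u x <= rsum u l.
Proof.
  intros H Hx. destruct (in_split x l Hx) as [l1 [l2 E]]. subst l.
  rewrite rsum_app. simpl.
  assert (0 <= rsum u l1) by (apply rsum_ge0; intros; apply H; apply in_or_app; auto).
  assert (0 <= rsum u l2)
    by (apply rsum_ge0; intros; apply H; apply in_or_app; simpl; auto).
  unfold rsum in *. simpl. lra.
Qed.

Lemma Cmod_csum_le f u l :
  (forall x, In x l -> Cmod (f x) <= u x) -> Cmod (csum f l) <= rsum u l.
Proof.
  unfold csum, lsum, rsum. induction l as [|x l IH]; simpl; intros H.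
  - rewrite Cmod_0. lra.
  - eapply Rle_trans; [apply Cmod_triangle|].
    apply Rplus_le_compat; [apply H; auto | apply IH; intros; apply H; auto].
Qed.

Lemma incl_NoDup_Permutation l l' :
  NoDup l -> incl l l' -> exists r, Permutation l' (l ++ r).
Proof.
  revert l'. induction l as [|x l IH]; intros l' Hn Hi.
  - exists l'. reflexivity.
  - inversion Hn as [|? ? Hx Hl]; subst.
    destruct (in_split x l') as [l1 [l2 E]]; [apply Hi; simpl; auto|]. subst l'.
    destruct (IH (l1 ++ l2)) as [r Hr]; [exact Hl| |].
    + intros y Hy. assert (Hy' : In y (l1 ++ x :: l2)) by (apply Hi; simpl; auto).
      apply in_app_or in Hy'. apply in_or_app. destruct Hy' as [|[->|]]; auto.
      contradiction.
    + exists r. simpl. rewrite <- Permutation_middle. constructor. exact Hr.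
Qed.

(** Up to a permutation [l'] is [l] followed by a remainder, and both differences are sums over this
    remainder. *)
Lemma csum_incl_diff f u l l' :
  NoDup l -> incl l l' -> (forall x, In x l' -> Cmod (f x) <= u x) ->
  Cmod (csum f l' - csum f l) <= rsum u l' - rsum u l.
Proof.
  intros Hn Hi H. destruct (incl_NoDup_Permutation l l' Hn Hi) as [r Hr].
  rewrite (csum_perm _ _ _ Hr), (rsum_perm _ _ _ Hr), csum_app, rsum_app.
  replace (csum f l + csum f r - csum f l)%C with (csum f r) by ring.
  replace (rsum u l + rsum u r - rsum u l) with (rsum u r) by ring.
  apply Cmod_csum_le. intros x Hx. apply H.
  apply (Permutation_in _ (Permutation_sym Hr)). apply in_or_app. auto.
Qed.

Lemma rsum_incl_le u l l' :
  NoDup l -> incl l l' -> (forall x, In x l' -> 0 <= u x) -> rsum u l <= rsum u l'.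
Proof.
  intros Hn Hi H. destruct (incl_NoDup_Permutation l l' Hn Hi) as [r Hr].
  rewrite (rsum_perm _ _ _ Hr), rsum_app.
  assert (0 <= rsum u r).
  { apply rsum_ge0. intros x Hx. apply H.
    apply (Permutation_in _ (Permutation_sym Hr)). apply in_or_app. auto. }
  lra.
Qed.

End FiniteSums.

Lemma csum_map {X Y : Type} (h : X -> Y) (f : Y -> C) (l : list X) :
  csum f (map h l) = csum (fun x => f (h x)) l.
Proof. unfold csum. rewrite map_map. reflexivity. Qed.

Lemma rsum_map {X Y : Type} (h : X -> Y) (u : Y -> R) (l : list X) :
  rsum u (map h l) = rsum (fun x => u (h x)) l.
Proof. unfold rsum. induction l as [|x l IH]; simpl; [reflexivity|]. rewrite IH. reflexivity. Qed.

Lemma csum_flat_map {X Y : Type} (h : X -> list Y) (f : Y -> C) (l : list X) :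
  csum f (flat_map h l) = csum (fun x => csum f (h x)) l.
Proof.
  induction l as [|x l IH]; simpl; [reflexivity|]. rewrite csum_app, IH. reflexivity.
Qed.

Lemma rsum_flat_map {X Y : Type} (h : X -> list Y) (u : Y -> R) (l : list X) :
  rsum u (flat_map h l) = rsum (fun x => rsum u (h x)) l.
Proof.
  induction l as [|x l IH]; simpl; [reflexivity|]. rewrite rsum_app, IH. reflexivity.
Qed.

Lemma csum_exchange {X Y : Type} (f : X -> Y -> C) (l : list X) (l' : list Y) :
  csum (fun x => csum (f x) l') l = csum (fun y => csum (fun x => f x y) l) l'.
Proof.
  induction l as [|x l IH].
  - unfold csum at 1. simpl. induction l' as [|y l' IH']; [reflexivity|].
    unfold csum in *. simpl in *. rewrite <- IH'. ring.
  - change (csum (f x) l' + csum (fun x => csum (f x) l') l =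
            csum (fun y => f x y + csum (fun x => f x y) l) l')%C.
    rewrite IH, csum_plus. reflexivity.
Qed.

Lemma rsum_exchange {X Y : Type} (f : X -> Y -> R) (l : list X) (l' : list Y) :
  rsum (fun x => rsum (f x) l') l = rsum (fun y => rsum (fun x => f x y) l) l'.
Proof.
  induction l as [|x l IH].
  - simpl. induction l' as [|y l' IH']; [reflexivity|].
    unfold rsum in *. simpl in *. rewrite <- IH'. ring.
  - change (rsum (f x) l' + rsum (fun x => rsum (f x) l') l =
            rsum (fun y => f x y + rsum (fun x => f x y) l) l').
    rewrite IH, rsum_plus. reflexivity.
Qed.

Lemma Ctends_csum {T X : Type} (F : (T -> Prop) -> Prop) {FF : Filter F}
    (f : T -> X -> C) (g : X -> C) (l : list X) :
  (forall x, In x l -> Ctends F (fun s => f s x) (g x)) ->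
  Ctends F (fun s => csum (f s) l) (csum g l).
Proof.
  induction l as [|x l IH]; intros H.
  - unfold csum; simpl. apply Ctends_const.
  - change (Ctends F (fun s => f s x + csum (f s) l)%C (g x + csum g l)%C).
    apply Ctends_plus; [apply H; simpl; auto | apply IH; intros; apply H; simpl; auto].
Qed.

(** * Absolutely summable families along an exhaustion *)

Record exhaustion {X : Type} (L : nat -> list X) : Prop := {
  exh_NoDup : forall N, NoDup (L N);
  exh_incl : forall N M, (N <= M)%nat -> incl (L N) (L M)
}.

(** [S] is only an upper bound for the partial sums, so it can be enlarged freely and need not be
    computed. *)
Record summable {X : Type} (L : nat -> list X) (u : X -> R) (S : R) : Prop := {
  smb_ge0 : forall N x, In x (L N) -> 0 <= u x;
  smb_le : forall N, rsum u (L N) <= S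
}.

Definition dominated {X : Type} (L : nat -> list X) (f : X -> C) (u : X -> R) : Prop :=
  forall N x, In x (L N) -> Cmod (f x) <= u x.

Definition limsum {X : Type} (L : nat -> list X) (f : X -> C) : C :=
  Clim (fun N => csum f (L N)).

Section Exhaustion.
Context {X : Type} (L : nat -> list X) (HL : exhaustion L).
Context (u : X -> R) (S : R) (Hu : summable L u S).

(** The partial sums increase to a finite limit, which exceeds the [M]-th one by less than [eps] for
    large [M]. Since every partial sum is below the limit, [M'] may be arbitrary. *)
Lemma summable_tail (eps : R) :
  0 < eps -> exists N, forall M M', (N <= M)%nat -> rsum u (L M') - rsum u (L M) < eps.
Proof.
  intros He.
  assert (Hmono : forall N M, (N <= M)%nat -> rsum u (L N) <= rsum u (L M)).
  { intros N M HNM. apply rsum_incl_le.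
    - apply (exh_NoDup _ HL).
    - apply (exh_incl _ HL). exact HNM.
    - apply (smb_ge0 _ _ _ Hu). }
  destruct (ex_finite_lim_seq_incr (fun N => rsum u (L N)) S) as [l Hl].
  - intros n. apply Hmono. lia.
  - apply (smb_le _ _ _ Hu).
  - assert (Hle : forall M, rsum u (L M) <= l).
    { intros M. apply (is_lim_seq_incr_compare (fun N => rsum u (L N)) l Hl).
      intros n. apply Hmono. lia. }
    apply is_lim_seq_spec in Hl. destruct (Hl (mkposreal _ He)) as [N HN].
    exists N. intros M M' HM. specialize (HN M HM). simpl in HN.
    apply Rabs_def2 in HN. specialize (Hle M'). lra.
Qed.

Lemma limsum_correct (f : X -> C) :
  dominated L f u -> Ctends eventually (fun N => csum f (L N)) (limsum L f).
Proof.
  intros Hf. apply Clim_cauchy. intros eps He.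
  destruct (summable_tail eps He) as [N HN]. exists N. intros m Hm.
  apply Rle_lt_trans with (rsum u (L m) - rsum u (L N)).
  - apply csum_incl_diff; [apply (exh_NoDup _ HL) | apply (exh_incl _ HL); exact Hm | apply Hf].
  - apply HN. lia.
Qed.

Lemma limsum_bound (f : X -> C) : dominated L f u -> Cmod (limsum L f) <= S.
Proof.
  intros Hf. apply (Ctends_le _ _ _ (limsum_correct f Hf)).
  apply filter_forall. intros N.
  eapply Rle_trans; [apply Cmod_csum_le; apply Hf | apply (smb_le _ _ _ Hu)].
Qed.

(** Unconditional convergence: a finite set between [L N] and some [L M] differs from [L N] by at
    most a tail, whatever its shape, and so does the limit. This applies to translated boxes, which
    are not members of the exhaustion. *)
Lemma limsum_approx (f : X -> C) (eps : R) (N : nat) (l : list X) :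
  dominated L f u -> (forall M, rsum u (L M) - rsum u (L N) <= eps) ->
  NoDup l -> incl (L N) l -> (exists M, incl l (L M)) ->
  Cmod (csum f l - limsum L f) <= 2 * eps.
Proof.
  intros Hf HN Hl Hi [M HM].
  assert (H1 : Cmod (csum f l - csum f (L N)) <= eps).
  { eapply Rle_trans.
    - apply csum_incl_diff with (u := u); [apply (exh_NoDup _ HL) | exact Hi |].
      intros x Hx. apply (Hf M). apply HM. exact Hx.
    - apply Rle_trans with (2 := HN M). apply Rplus_le_compat_r.
      apply rsum_incl_le; [exact Hl | exact HM | apply (smb_ge0 _ _ _ Hu)]. }
  assert (H2 : Cmod (limsum L f - csum f (L N)) <= eps).
  { apply (Ctends_le (F := eventually) (fun M => csum f (L M) - csum f (L N))%C).
    - apply Ctends_minus; [apply limsum_correct; exact Hf | apply Ctends_const].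
    - exists N. intros m Hm. eapply Rle_trans; [|apply (HN m)].
      apply csum_incl_diff; [apply (exh_NoDup _ HL) | apply (exh_incl _ HL); exact Hm | apply Hf]. }
  replace (csum f l - limsum L f)%C
    with ((csum f l - csum f (L N)) + - (limsum L f - csum f (L N)))%C by ring.
  eapply Rle_trans; [apply Cmod_triangle|]. rewrite Cmod_opp. lra.
Qed.

(* The filter is arbitrary, so this single statement covers sequences, continuity
   and difference quotients alike. *)
Lemma limsum_dominated_convergence {T : Type} (F : (T -> Prop) -> Prop) {FF : Filter F}
    (f : T -> X -> C) (g : X -> C) :
  F (fun s => dominated L (f s) u) -> dominated L g u ->
  (forall N x, In x (L N) -> Ctends F (fun s => f s x) (g x)) ->
  Ctends F (fun s => limsum L (f s)) (limsum L g).
Proof.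
  intros Hf Hg Hc eps He.
  (* Each of the two truncations costs [2 * (eps / 6)] and the finite sums differ by less than
     [eps / 6]. *)
  assert (He' : 0 < eps / 6) by lra.
  destruct (summable_tail _ He') as [N HN].
  assert (Happ : forall h, dominated L h u ->
    Cmod (csum h (L N) - limsum L h) <= 2 * (eps / 6)).
  { intros h Hh. apply limsum_approx with (N := N); auto.
    - intros M. apply Rlt_le. apply HN. lia.
    - apply (exh_NoDup _ HL).
    - intros x Hx; exact Hx.
    - exists N. intros x Hx; exact Hx. }
  assert (Hs := Ctends_csum F f g (L N) (Hc N) _ He').
  generalize (filter_and _ _ Hf Hs). apply filter_imp. intros s [A B].
  replace (limsum L (f s) - limsum L g)%C
    with (- (csum (f s) (L N) - limsum L (f s)) + (csum (f s) (L N) - csum g (L N))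
          + (csum g (L N) - limsum L g))%C by ring.
  eapply Rle_lt_trans; [apply Cmod_triangle|].
  eapply Rle_lt_trans; [apply Rplus_le_compat_r; apply Cmod_triangle|].
  rewrite Cmod_opp. pose proof (Happ _ A). pose proof (Happ _ Hg). lra.
Qed.

End Exhaustion.

Lemma limsum_ext {X : Type} (L : nat -> list X) (f g : X -> C) :
  (forall N x, In x (L N) -> f x = g x) -> limsum L f = limsum L g.
Proof.
  intros H. unfold limsum, Clim. f_equal; f_equal; apply Lim_seq_ext; intros N;
    rewrite (csum_ext f g (L N) (H N)); reflexivity.
Qed.

Lemma limsum_scal {X : Type} (L : nat -> list X) (HL : exhaustion L) (u : X -> R) (S : R)
    (Hu : summable L u S) (k : C) (f : X -> C) :
  dominated L f u -> limsum L (fun x => k * f x)%C = (k * limsum L f)%C.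
Proof.
  intros Hf. apply Clim_correct.
  apply Ctends_ext with (fun N => k * csum f (L N))%C.
  - intros N. rewrite csum_scal. reflexivity.
  - apply Ctends_scal. apply (limsum_correct L HL u S Hu f Hf).
Qed.

Lemma limsum_plus {X : Type} (L : nat -> list X) (HL : exhaustion L) (u v : X -> R) (S S' : R)
    (Hu : summable L u S) (Hv : summable L v S') (f g : X -> C) :
  dominated L f u -> dominated L g v ->
  limsum L (fun x => f x + g x)%C = (limsum L f + limsum L g)%C.
Proof.
  intros Hf Hg. apply Clim_correct.
  apply Ctends_ext with (fun N => csum f (L N) + csum g (L N))%C.
  - intros N. rewrite csum_plus. reflexivity.
  - apply Ctends_plus; [apply (limsum_correct L HL u S Hu f Hf) |
                        apply (limsum_correct L HL v S' Hv g Hg)].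
Qed.

(** * Boxes and tuples of boxes exhaust the lattice *)

Lemma NoDup_flat_map_cons {Y : Type} (l : list Y) (L : list (list Y)) :
  NoDup l -> NoDup L -> NoDup (flat_map (fun v => map (fun z => z :: v) l) L).
Proof.
  intros Hl. induction L as [|v L IH]; intros HL; simpl; [constructor|].
  inversion HL as [|? ? Hv HL']; subst.
  apply NoDup_app.
  - apply FinFun.Injective_map_NoDup; [|exact Hl]. intros x y E. congruence.
  - apply IH. exact HL'.
  - intros a Ha Hb. apply in_map_iff in Ha. destruct Ha as [z [<- Hz]].
    apply in_flat_map in Hb. destruct Hb as [v' [Hv' Hz']].
    apply in_map_iff in Hz'. destruct Hz' as [z' [E _]]. congruence.
Qed.

Lemma In_flat_map_cons {Y : Type} (l : list Y) (L : list (list Y)) (x : Y) (v : list Y) :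
  In (x :: v) (flat_map (fun v => map (fun z => z :: v) l) L) <-> In x l /\ In v L.
Proof.
  rewrite in_flat_map. split.
  - intros [v' [Hv Hx]]. apply in_map_iff in Hx. destruct Hx as [z [E Hz]].
    inversion E; subst. auto.
  - intros [Hx Hv]. exists v. split; [exact Hv|]. apply in_map_iff. exists x. auto.
Qed.

Lemma nil_not_In_flat_map_cons {Y : Type} (l : list Y) (L : list (list Y)) :
  ~ In [] (flat_map (fun v => map (fun z => z :: v) l) L).
Proof.
  rewrite in_flat_map. intros [v [_ H]]. apply in_map_iff in H.
  destruct H as [z [E _]]. discriminate.
Qed.

Lemma In_zrange (N : nat) (z : Z) : In z (zrange N) <-> (Z.abs z <= Z.of_nat N)%Z.
Proof.
  unfold zrange. rewrite in_map_iff. split.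
  - intros [k [<- Hk]]. apply in_seq in Hk. lia.
  - intros H. exists (Z.to_nat (z + Z.of_nat N)). split; [lia|]. apply in_seq. lia.
Qed.

Lemma NoDup_zrange (N : nat) : NoDup (zrange N).
Proof.
  apply FinFun.Injective_map_NoDup; [|apply seq_NoDup]. intros x y. lia.
Qed.

Lemma In_box (N k : nat) (v : list Z) :
  In v (box N k) <-> length v = k /\ List.Forall (fun z => (Z.abs z <= Z.of_nat N)%Z) v.
Proof.
  revert v. induction k as [|k IH]; intros v; simpl.
  - split.
    + intros [<-|[]]. auto.
    + intros [H _]. destruct v; [auto|discriminate].
  - destruct v as [|z v].
    + split; [intros H; exfalso; exact (nil_not_In_flat_map_cons _ _ H) | intros [H _]; discriminate].
    + rewrite In_flat_map_cons, In_zrange, IH. simpl. split.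
      * intros [H1 [H2 H3]]. split; [lia|constructor; auto].
      * intros [H1 H2]. inversion H2; subst. split; [assumption|]. split; [lia|assumption].
Qed.

Lemma In_tuples (N nu m : nat) (ts : list (list Z)) :
  In ts (tuples N nu m) <-> length ts = m /\ List.Forall (fun v => In v (box N nu)) ts.
Proof.
  revert ts. induction m as [|m IH]; intros ts; simpl.
  - split.
    + intros [<-|[]]. auto.
    + intros [H _]. destruct ts; [auto|discriminate].
  - destruct ts as [|v ts].
    + split; [intros H; exfalso; exact (nil_not_In_flat_map_cons _ _ H) | intros [H _]; discriminate].
    + rewrite In_flat_map_cons, IH. simpl. split.
      * intros [H1 [H2 H3]]. split; [lia|constructor; auto].
      * intros [H1 H2]. inversion H2; subst. split; [assumption|]. split; [lia|assumption].
Qed.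

Lemma box_incl (nu N M : nat) : (N <= M)%nat -> incl (box N nu) (box M nu).
Proof.
  intros H v. rewrite !In_box. intros [H1 H2]. split; [exact H1|].
  apply Forall_impl with (2 := H2). intros z Hz. lia.
Qed.

Lemma box_exhaustion (nu : nat) : exhaustion (fun N => box N nu).
Proof.
  split.
  - intros N. induction nu as [|k IH]; simpl.
    + constructor; [intros []|constructor].
    + apply NoDup_flat_map_cons; [apply NoDup_zrange | exact IH].
  - apply box_incl.
Qed.

Lemma tuples_exhaustion (nu m : nat) : exhaustion (fun N => tuples N nu m).
Proof.
  split.
  - intros N. induction m as [|m IH]; simpl.
    + constructor; [intros []|constructor].
    + apply NoDup_flat_map_cons; [apply (exh_NoDup _ (box_exhaustion nu)) | exact IH].
  - intros N M H ts. rewrite !In_tuples. intros [H1 H2]. split; [exact H1|].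
    apply Forall_impl with (2 := H2). intros v Hv. apply (box_incl nu N M H). exact Hv.
Qed.

Lemma In_box_length (N nu : nat) (v : list Z) : In v (box N nu) -> length v = nu.
Proof. rewrite In_box. tauto. Qed.

Lemma In_box_ex (nu : nat) (v : list Z) : length v = nu -> exists N, In v (box N nu).
Proof.
  intros <-. induction v as [|z v [N HN]].
  - exists O. simpl. auto.
  - exists (Nat.max N (Z.to_nat (Z.abs z))). apply In_box. split; [reflexivity|].
    apply In_box in HN. destruct HN as [_ HN]. constructor; [lia|].
    apply Forall_impl with (2 := HN). intros y Hy. lia.
Qed.

Lemma In_tuples_length (N nu m : nat) (ts : list (list Z)) :
  In ts (tuples N nu m) -> List.Forall (fun v => length v = nu) ts.
Proof.
  rewrite In_tuples. intros [_ H]. apply Forall_impl with (2 := H).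
  intros v. apply In_box_length.
Qed.

(** * Lattice vectors *)

Lemma length_vadd (nu : nat) (x y : list Z) :
  length x = nu -> length y = nu -> length (vadd x y) = nu.
Proof.
  revert nu y. induction x as [|a x IH]; intros nu [|b y]; simpl; intros H1 H2; try congruence.
  destruct nu; [discriminate|]. f_equal. apply IH; congruence.
Qed.

Lemma length_vsub (nu : nat) (x y : list Z) :
  length x = nu -> length y = nu -> length (vsub x y) = nu.
Proof.
  revert nu y. induction x as [|a x IH]; intros nu [|b y]; simpl; intros H1 H2; try congruence.
  destruct nu; [discriminate|]. f_equal. apply IH; congruence.
Qed.

Lemma length_vsum (nu : nat) (ts : list (list Z)) :
  List.Forall (fun v => length v = nu) ts -> length (vsum nu ts) = nu.
Proof.
  induction 1 as [|v ts Hv _ IH]; simpl; [apply repeat_length|].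
  apply length_vadd; assumption.
Qed.

(** [vadd] and [vsub] stop at the end of the shorter list, so cancellation relies on equal
    lengths. *)
Lemma vadd_vsub (x y : list Z) : length x = length y -> vsub (vadd x y) y = x.
Proof.
  revert y. induction x as [|a x IH]; intros [|b y]; simpl; intros H; try discriminate; [reflexivity|].
  rewrite IH by congruence. f_equal. lia.
Qed.

Lemma vsub_vadd (x y : list Z) : length x = length y -> vadd (vsub x y) y = x.
Proof.
  revert y. induction x as [|a x IH]; intros [|b y]; simpl; intros H; try discriminate; [reflexivity|].
  rewrite IH by congruence. f_equal. lia.
Qed.

Lemma zl1_ge0 (n : list Z) : 0 <= zl1 n.
Proof.
  induction n as [|z n IH]; simpl; [lra|]. pose proof (Rabs_pos (IZR z)). lra.
Qed.

Lemma zl1_vadd (x y : list Z) : zl1 (vadd x y) <= zl1 x + zl1 y.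
Proof.
  revert y. induction x as [|a x IH]; intros [|b y]; simpl.
  - lra.
  - pose proof (zl1_ge0 y). pose proof (Rabs_pos (IZR b)). lra.
  - pose proof (zl1_ge0 x). pose proof (Rabs_pos (IZR a)). lra.
  - rewrite plus_IZR. pose proof (Rabs_triang (IZR a) (IZR b)). pose proof (IH y). lra.
Qed.

Lemma zl1_vsum (nu : nat) (ts : list (list Z)) : zl1 (vsum nu ts) <= rsum zl1 ts.
Proof.
  induction ts as [|v ts IH]; simpl.
  - induction nu as [|k IH]; simpl; [lra|]. rewrite Rabs_R0. simpl in IH. lra.
  - pose proof (zl1_vadd v (vsum nu ts)). unfold vsum in *. simpl in *.
    unfold rsum in *. simpl in *. lra.
Qed.

Lemma zdot_vadd (x y : list Z) (w : list R) :
  length x = length y -> zdot (vadd x y) w = zdot x w + zdot y w.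
Proof.
  revert y w. induction x as [|a x IH]; intros [|b y] w; simpl; intros H; try discriminate.
  - lra.
  - destruct w as [|c w]; [lra|]. rewrite IH by congruence. rewrite plus_IZR. ring.
Qed.

Lemma zdot_vsum (nu : nat) (ts : list (list Z)) (w : list R) :
  List.Forall (fun v => length v = nu) ts ->
  zdot (vsum nu ts) w = rsum (fun v => zdot v w) ts.
Proof.
  induction 1 as [|v ts Hv Hts IH]; simpl.
  - revert w. induction nu as [|k IH]; intros w; simpl; [reflexivity|].
    destruct w; [reflexivity|]. rewrite IH. lra.
  - fold (vsum nu ts). rewrite zdot_vadd, IH; [reflexivity|].
    rewrite Hv, length_vsum; auto.
Qed.

Lemma rnorm_ge0 (w : list R) : 0 <= rnorm w.
Proof. apply sqrt_pos. Qed.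

(** Every component of [w] is at most its Euclidean norm, and so is the norm of the tail, which lets
    the induction run. *)
Lemma zdot_le (n : list Z) (w : list R) : Rabs (zdot n w) <= zl1 n * rnorm w.
Proof.
  assert (Hsq : forall w', 0 <= fold_right (fun a s => a * a + s) 0 w').
  { induction w' as [|a w' IH]; simpl; [lra|]. nra. }
  revert w. induction n as [|z n IH]; intros w; simpl.
  - rewrite Rabs_R0. lra.
  - destruct w as [|a w].
    + rewrite Rabs_R0. unfold rnorm. simpl. rewrite sqrt_0. lra.
    + assert (H1 : Rabs a <= rnorm (a :: w)).
      { unfold rnorm. simpl. rewrite <- sqrt_Rsqr_abs. apply sqrt_le_1_alt.
        pose proof (Hsq w). unfold Rsqr. lra. }
      assert (H2 : rnorm w <= rnorm (a :: w)).
      { unfold rnorm. simpl. apply sqrt_le_1_alt. nra. }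
      eapply Rle_trans; [apply Rabs_triang|]. rewrite Rabs_mult.
      pose proof (IH w). pose proof (zl1_ge0 n). pose proof (Rabs_pos (IZR z)).
      rewrite Rmult_plus_distr_r. apply Rplus_le_compat.
      * apply Rmult_le_compat_l; assumption.
      * eapply Rle_trans; [eassumption|]. apply Rmult_le_compat_l; assumption.
Qed.

(** If the norm vanished, the first unit vector would have zero product with [w], against rational
    independence. Positivity is needed for the denominators of the existence time. *)
Lemma rnorm_pos (nu : nat) (w : list R) :
  (1 <= nu)%nat -> length w = nu -> rat_indep nu w -> 0 < rnorm w.
Proof.
  intros Hnu Hw Hi. destruct nu as [|k]; [lia|].
  destruct (Rle_lt_or_eq_dec _ _ (rnorm_ge0 w)) as [H|H]; [exact H|exfalso].
  set (n := 1%Z :: repeat 0%Z k).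
  assert (Hn : length n = S k) by (simpl; rewrite repeat_length; reflexivity).
  assert (Hz : zdot n w = 0).
  { pose proof (zdot_le n w) as Hle. rewrite <- H, Rmult_0_r in Hle.
    pose proof (Rabs_pos (zdot n w)).
    destruct (Req_dec (zdot n w) 0) as [E|E]; [exact E|].
    apply Rabs_pos_lt in E. lra. }
  specialize (Hi n Hn Hz). inversion Hi. discriminate.
Qed.

(** * Geometric sums over boxes *)

Lemma zrange_S_Permutation (N : nat) :
  Permutation (zrange (S N)) (Z.of_nat (S N) :: (- Z.of_nat (S N))%Z :: zrange N).
Proof.
  apply NoDup_Permutation.
  - apply NoDup_zrange.
  - constructor; [|constructor; [|apply NoDup_zrange]].
    + cbn [In]. rewrite In_zrange. lia.
    + rewrite In_zrange. lia.
  - intros z. cbn [In]. rewrite !In_zrange. lia.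
Qed.

(** With $q=e^{-r}$ the two-sided geometric sum is below $(1+q)/(1-q)$, and the claimed bound by
    $2/r+1$ is equivalent to $q(1+r)\le1$, that is, to $1+r\le e^r$. *)
Lemma rsum_exp_zrange (r : R) (N : nat) :
  0 < r -> rsum (fun z => exp (- r * Rabs (IZR z))) (zrange N) <= 2 / r + 1.
Proof.
  intros Hr. set (q := exp (- r)).
  assert (Hpow : forall n : nat, exp (- r * INR n) = q ^ n).
  { intros n. unfold q. induction n as [|n IH].
    - simpl. rewrite Rmult_0_r, exp_0. reflexivity.
    - rewrite S_INR. simpl. rewrite <- IH, <- exp_plus. f_equal. ring. }
  assert (Hq : 0 < q) by apply exp_pos.
  assert (Hq1 : q * (1 + r) <= 1).
  { unfold q. rewrite <- (exp_0). replace 0 with (- r + r) at 2 by ring. rewrite exp_plus.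
    apply Rmult_le_compat_l; [apply Rlt_le; apply exp_pos|].
    rewrite exp_0. apply exp_ineq1_le. }
  assert (Heq : (1 - q) * rsum (fun z => exp (- r * Rabs (IZR z))) (zrange N)
                = 1 + q - 2 * q ^ (S N)).
  { induction N as [|N IH].
    - unfold zrange, rsum. simpl. rewrite Rabs_R0, Rmult_0_r, exp_0. ring.
    - rewrite (rsum_perm _ _ _ (zrange_S_Permutation N)).
      change (rsum (fun z : Z => exp (- r * Rabs (IZR z)))
                (Z.of_nat (S N) :: (- Z.of_nat (S N))%Z :: zrange N))
        with (exp (- r * Rabs (IZR (Z.of_nat (S N)))) +
              (exp (- r * Rabs (IZR (- Z.of_nat (S N)))) +
               rsum (fun z : Z => exp (- r * Rabs (IZR z))) (zrange N))).
      rewrite opp_IZR, Rabs_Ropp, <- INR_IZR_INZ, Rabs_pos_eq by apply pos_INR.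
      rewrite !Hpow, !Rmult_plus_distr_l, IH. simpl. ring. }
  assert (Hqr : 0 < q * r) by (apply Rmult_lt_0_compat; lra).
  assert (Hqq : q < 1) by lra.
  assert (0 <= q ^ S N) by (apply pow_le; lra).
  apply Rmult_le_reg_l with (r := 1 - q); [lra|]. rewrite Heq.
  apply Rle_trans with (1 + q); [lra|].
  apply Rmult_le_reg_l with (r := r); [exact Hr|].
  replace (r * ((1 - q) * (2 / r + 1))) with ((1 - q) * (2 + r)) by (field; lra).
  nra.
Qed.

(** The $\ell^1$ norm turns the exponential into a product over the coordinates, so the sum over a
    box factorises. *)
Lemma rsum_exp_box (r : R) (N k : nat) :
  rsum (fun n => exp (- r * zl1 n)) (box N k)
  = rsum (fun z => exp (- r * Rabs (IZR z))) (zrange N) ^ k.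
Proof.
  induction k as [|k IH].
  - unfold rsum. simpl. rewrite Rmult_0_r, exp_0. ring.
  - simpl box. rewrite rsum_flat_map.
    rewrite (rsum_ext _ (fun v => rsum (fun z => exp (- r * Rabs (IZR z))) (zrange N)
                                  * exp (- r * zl1 v))).
    + rewrite rsum_scal, IH. reflexivity.
    + intros v _. rewrite rsum_map, Rmult_comm, <- rsum_scal. apply rsum_ext.
      intros z _. rewrite <- exp_plus. f_equal. simpl. ring.
Qed.

Lemma summable_exp (nu : nat) (r : R) :
  0 < r -> summable (fun N => box N nu) (fun n => exp (- r * zl1 n)) ((2 / r + 1) ^ nu).
Proof.
  intros Hr. split.
  - intros N x _. apply Rlt_le, exp_pos.
  - intros N. rewrite rsum_exp_box. apply pow_incr. split.
    + apply rsum_ge0. intros; apply Rlt_le, exp_pos.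
    + apply rsum_exp_zrange. exact Hr.
Qed.

Lemma summable_scal {X : Type} (L : nat -> list X) (u : X -> R) (S k : R) :
  0 <= k -> summable L u S -> summable L (fun x => k * u x) (k * S).
Proof.
  intros Hk [H1 H2]. split.
  - intros N x Hx. apply Rmult_le_pos; [exact Hk | apply (H1 N x Hx)].
  - intros N. rewrite rsum_scal. apply Rmult_le_compat_l; auto.
Qed.

Lemma summable_le {X : Type} (L : nat -> list X) (u v : X -> R) (S : R) :
  (forall N x, In x (L N) -> 0 <= v x <= u x) -> summable L u S -> summable L v S.
Proof.
  intros H [H1 H2]. split.
  - intros N x Hx. apply (H N x Hx).
  - intros N. eapply Rle_trans; [|apply (H2 N)]. apply rsum_le. intros x Hx. apply (H N x Hx).
Qed.

(** * Translations of boxes *)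

Section Vectors.
Variable nu : nat.

Definition boxes (N : nat) : list (list Z) := box N nu.

Lemma boxes_exhaustion : exhaustion boxes.
Proof. apply box_exhaustion. Qed.

Lemma summable_boxes_ge0 (b : list Z -> R) (S : R) (n : list Z) :
  summable boxes b S -> length n = nu -> 0 <= b n.
Proof.
  intros H Hn. destruct (In_box_ex nu n Hn) as [N HN]. apply (smb_ge0 _ _ _ H N n HN).
Qed.

Lemma summable_boxes_elem (b : list Z -> R) (S : R) (n : list Z) :
  summable boxes b S -> length n = nu -> b n <= S.
Proof.
  intros H Hn. destruct (In_box_ex nu n Hn) as [N HN].
  eapply Rle_trans; [|apply (smb_le _ _ _ H N)].
  apply rsum_ge_elem; [apply (smb_ge0 _ _ _ H) | exact HN].
Qed.

(** A box translated by a vector of size at most [K] lies between the boxes whose radii are smaller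
    and larger by [K]. This is the sandwich that [limsum_approx] asks for. *)
Lemma shift_box (v : list Z) (K N : nat) :
  In v (box K nu) ->
  NoDup (map (fun n => vsub n v) (box N nu)) /\
  incl (map (fun n => vsub n v) (box N nu)) (box (N + K) nu) /\
  forall M, (M + K <= N)%nat -> incl (box M nu) (map (fun n => vsub n v) (box N nu)).
Proof.
  intros Hv. pose proof (In_box_length _ _ _ Hv) as Hlv.
  assert (Habs : forall x y A B,
    List.Forall (fun z => (Z.abs z <= Z.of_nat A)%Z) x -> List.Forall (fun z => (Z.abs z <= Z.of_nat B)%Z) y ->
    List.Forall (fun z => (Z.abs z <= Z.of_nat (A + B))%Z) (vsub x y) /\
    List.Forall (fun z => (Z.abs z <= Z.of_nat (A + B))%Z) (vadd x y)).
  { intros x y A B Hx. revert y. induction Hx as [|a x Ha Hx IH]; intros y Hy; simpl; [auto|].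
    destruct Hy as [|b y Hb Hy]; [auto|]. destruct (IH y Hy).
    split; constructor; auto; lia. }
  split; [|split].
  - assert (Hnd := exh_NoDup _ (box_exhaustion nu) N). cbv beta in Hnd.
    assert (Hlen : forall n, In n (box N nu) -> length n = nu) by (intros n; apply In_box_length).
    induction (box N nu) as [|n l IH]; simpl; [constructor|].
    inversion Hnd as [|? ? Hn Hl]; subst. constructor.
    + intros H. apply in_map_iff in H. destruct H as [m [E Hm]]. apply Hn.
      assert (Hm' : length m = length v) by (apply Hlen; simpl; auto).
      assert (Hn' : length n = length v) by (apply Hlen; simpl; auto).
      rewrite <- (vsub_vadd n v Hn'), <- E, (vsub_vadd m v Hm'). exact Hm.
    + apply IH; auto. intros m Hm. apply Hlen. simpl. auto.
  - intros n Hn. apply in_map_iff in Hn. destruct Hn as [m [<- Hm]].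
    apply In_box in Hm. apply In_box in Hv. apply In_box. split.
    + apply length_vsub; tauto.
    + apply (Habs m v N K); tauto.
  - intros M HM n Hn. apply in_map_iff. exists (vadd n v).
    apply In_box in Hn. split.
    + apply vadd_vsub. rewrite Hlv. tauto.
    + apply (box_incl nu (M + K) N HM). apply In_box in Hv. apply In_box. split.
      * apply length_vadd; tauto.
      * apply (Habs n v M K); tauto.
Qed.

Lemma rsum_shift_le (b : list Z -> R) (S : R) (v : list Z) (N : nat) :
  summable boxes b S -> length v = nu ->
  rsum (fun n => b (vsub n v)) (box N nu) <= S.
Proof.
  intros Hb Hv. destruct (In_box_ex nu v Hv) as [K HK].
  destruct (shift_box v K N HK) as [H1 [H2 _]].
  rewrite <- (rsum_map (fun n => vsub n v) b).
  eapply Rle_trans; [|apply (smb_le _ _ _ Hb (N + K))].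
  apply rsum_incl_le; [exact H1 | exact H2 | apply (smb_ge0 _ _ _ Hb)].
Qed.

(** Translation invariance of the lattice sum: since the translated boxes eventually contain any
    given box, they exhaust the lattice as well. *)
Lemma csum_shift_tends (a : list Z -> C) (b : list Z -> R) (S : R) (v : list Z) :
  summable boxes b S -> dominated boxes a b -> length v = nu ->
  Ctends eventually (fun N => csum (fun n => a (vsub n v)) (box N nu)) (limsum boxes a).
Proof.
  intros Hb Ha Hv eps He. destruct (In_box_ex nu v Hv) as [K HK].
  assert (He' : 0 < eps / 4) by lra.
  destruct (summable_tail _ boxes_exhaustion b S Hb _ He') as [M HM].
  exists (M + K)%nat. intros N HN.
  destruct (shift_box v K N HK) as [H1 [H2 H3]].
  rewrite <- (csum_map (fun n => vsub n v) a).
  apply Rle_lt_trans with (2 * (eps / 4)); [|lra].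
  apply (limsum_approx _ boxes_exhaustion b S Hb) with (N := M).
  - exact Ha.
  - intros M'. apply Rlt_le, HM. lia.
  - exact H1.
  - apply H3. lia.
  - exists (N + K)%nat. exact H2.
Qed.

(** * Convolution powers *)

Definition cprod (a : list Z -> C) (l : list (list Z)) : C := fold_right Cmult 1%C (map a l).
Definition rprod (b : list Z -> R) (l : list (list Z)) : R := fold_right (fun v s => b v * s) 1 l.

(** The summand of [conv], with the last index determined by the free ones; it is written so that
    [conv] is a [limsum] by definition. *)
Definition cterm (a : list Z -> C) (n : list Z) (ts : list (list Z)) : C :=
  Cmult (cprod a ts) (a (vsub n (vsum nu ts))).
Definition rterm (b : list Z -> R) (n : list Z) (ts : list (list Z)) : R :=
  rprod b ts * b (vsub n (vsum nu ts)).

Variable p : nat.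
Hypothesis Hp : (1 <= p)%nat.

Definition tups (N : nat) : list (list (list Z)) := tuples N nu (p - 1).

Lemma tups_exhaustion : exhaustion tups.
Proof. apply tuples_exhaustion. Qed.

Lemma conv_limsum (a : list Z -> C) (n : list Z) : conv p nu a n = limsum tups (cterm a n).
Proof. reflexivity. Qed.

Lemma In_tups_length (N : nat) (ts : list (list Z)) :
  In ts (tups N) -> List.Forall (fun v => length v = nu) ts.
Proof. apply In_tuples_length. Qed.

Lemma length_last (N : nat) (n : list Z) (ts : list (list Z)) :
  length n = nu -> In ts (tups N) -> length (vsub n (vsum nu ts)) = nu.
Proof.
  intros Hn Hts. apply length_vsub; [exact Hn|]. apply length_vsum.
  apply (In_tups_length N). exact Hts.
Qed.

Lemma rprod_ge0 (b : list Z -> R) (l : list (list Z)) :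
  (forall v, In v l -> 0 <= b v) -> 0 <= rprod b l.
Proof.
  unfold rprod. induction l as [|v l IH]; simpl; intros H; [lra|].
  apply Rmult_le_pos; [apply H; auto | apply IH; intros; apply H; auto].
Qed.

(** The identity $xP-x'P'=(x-x')P+x'(P-P')$ holds for the coefficients and for their majorants, so
    bounds on the factors and on their differences propagate with no constant. *)
Lemma cprod_diff_le (a a' : list Z -> C) (b b' : list Z -> R) (l : list (list Z)) :
  (forall v, In v l -> Cmod (a v) <= b v /\ Cmod (a' v) <= b' v /\ Cmod (a v - a' v) <= b v - b' v) ->
  Cmod (cprod a l) <= rprod b l /\ Cmod (cprod a' l) <= rprod b' l /\
  Cmod (cprod a l - cprod a' l) <= rprod b l - rprod b' l.
Proof.
  induction l as [|v l IH]; intros H.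
  - unfold cprod, rprod; simpl. rewrite Cmod_1.
    replace (1 - 1)%C with (RtoC 0) by ring. rewrite Cmod_0. lra.
  - destruct IH as [I1 [I2 I3]]; [intros; apply H; simpl; auto|].
    destruct (H v) as [H1 [H2 H3]]; [simpl; auto|].
    change (cprod a (v :: l)) with (a v * cprod a l)%C.
    change (cprod a' (v :: l)) with (a' v * cprod a' l)%C.
    change (rprod b (v :: l)) with (b v * rprod b l).
    change (rprod b' (v :: l)) with (b' v * rprod b' l).
    rewrite !Cmod_mult.
    pose proof (Cmod_ge_0 (a v)). pose proof (Cmod_ge_0 (a' v)).
    pose proof (Cmod_ge_0 (cprod a l)). pose proof (Cmod_ge_0 (cprod a' l)).
    pose proof (Cmod_ge_0 (a v - a' v)). pose proof (Cmod_ge_0 (cprod a l - cprod a' l)).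
    split; [|split].
    + apply Rmult_le_compat; assumption.
    + apply Rmult_le_compat; assumption.
    + replace (a v * cprod a l - a' v * cprod a' l)%C
        with ((a v - a' v) * cprod a l + a' v * (cprod a l - cprod a' l))%C by ring.
      eapply Rle_trans; [apply Cmod_triangle|]. rewrite !Cmod_mult.
      assert (Cmod (a v - a' v) * Cmod (cprod a l) <= (b v - b' v) * rprod b l)
        by (apply Rmult_le_compat; assumption).
      assert (Cmod (a' v) * Cmod (cprod a l - cprod a' l) <= b' v * (rprod b l - rprod b' l))
        by (apply Rmult_le_compat; assumption).
      lra.
Qed.

Lemma rprod_weight (b : list Z -> R) (y : R) (l : list (list Z)) :
  rprod (fun v => b v * exp (- y * zl1 v)) l = rprod b l * exp (- y * rsum zl1 l).
Proof.
  unfold rprod, rsum. induction l as [|v l IH]; simpl.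
  - rewrite Rmult_0_r, exp_0. ring.
  - rewrite IH, Rmult_plus_distr_l, exp_plus. ring.
Qed.

(** Two roles are separated: [b] carries the summability and the exponential carries the decay. For
    [y = 0] this is plain domination. *)
Definition majorized (y : R) (a : list Z -> C) (b : list Z -> R) : Prop :=
  forall n, length n = nu -> Cmod (a n) <= b n * exp (- y * zl1 n).

(** The weights of the factors multiply to $e^{-y\sum_j|n_j|}$, which is at most $e^{-y|n|}$ because
    $n=\sum_j n_j$ and $y\ge0$. The weight thus passes through the convolution unchanged. *)
Lemma cterm_diff_le (y : R) (a a' : list Z -> C) (b b' : list Z -> R)
    (N : nat) (n : list Z) (ts : list (list Z)) :
  0 <= y -> majorized y a b -> majorized y a' b' ->
  majorized y (fun n => a n - a' n)%C (fun n => b n - b' n) ->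
  length n = nu -> In ts (tups N) ->
  Cmod (cterm a n ts - cterm a' n ts) <= (rterm b n ts - rterm b' n ts) * exp (- y * zl1 n).
Proof.
  intros Hy Ha Ha' Hd Hn Hts.
  set (m := vsub n (vsum nu ts)).
  assert (Hm : length m = nu) by (apply (length_last N); assumption).
  assert (Hall : forall v, In v (m :: ts) -> length v = nu).
  { intros v [<-|Hv]; [exact Hm|]. apply In_tups_length in Hts.
    rewrite Forall_forall in Hts. auto. }
  assert (Hl : zl1 n <= rsum zl1 (m :: ts)).
  { pose proof (In_tups_length _ _ Hts) as HF. apply length_vsum in HF.
    rewrite <- (vsub_vadd n (vsum nu ts)) by congruence. fold m.
    eapply Rle_trans; [apply zl1_vadd|]. unfold rsum at 1. simpl.
    apply Rplus_le_compat_l. apply zl1_vsum. }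
  destruct (cprod_diff_le a a' (fun v => b v * exp (- y * zl1 v))
              (fun v => b' v * exp (- y * zl1 v)) (m :: ts)) as [_ [_ H]].
  { intros v Hv. specialize (Hall v Hv). split; [|split]; auto.
    rewrite <- Rmult_minus_distr_r. apply (Hd v Hall). }
  (* Applied to the majorants themselves, the product estimate shows that their difference is
     nonnegative; this allows the weight in front of it to be enlarged. *)
  destruct (cprod_diff_le (fun v => RtoC (b v)) (fun v => RtoC (b' v)) b b' (m :: ts))
    as [_ [_ H0]].
  { intros v Hv. specialize (Hall v Hv).
    assert (Hpos : forall s c, Cmod c <= s * exp (- y * zl1 v) -> 0 <= s).
    { intros s c Hs. pose proof (Cmod_ge_0 c). pose proof (exp_pos (- y * zl1 v)). nra. }
    pose proof (Hpos _ _ (Ha v Hall)). pose proof (Hpos _ _ (Ha' v Hall)).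
    pose proof (Hpos _ _ (Hd v Hall)).
    rewrite <- RtoC_minus, !Cmod_R, !Rabs_pos_eq by assumption. lra. }
  rewrite !rprod_weight, <- Rmult_minus_distr_r in H.
  assert (Hnn : 0 <= rprod b (m :: ts) - rprod b' (m :: ts))
    by (eapply Rle_trans; [apply Cmod_ge_0 | exact H0]).
  replace (cterm a n ts - cterm a' n ts)%C with (cprod a (m :: ts) - cprod a' (m :: ts))%C
    by (unfold cterm, cprod; simpl; fold m; ring).
  replace (rterm b n ts - rterm b' n ts) with (rprod b (m :: ts) - rprod b' (m :: ts))
    by (unfold rterm, rprod; simpl; fold m; ring).
  eapply Rle_trans; [exact H|]. apply Rmult_le_compat_l; [exact Hnn|].
  apply exp_le_compat. nra.
Qed.

Lemma majorized_zero (y : R) : majorized y (fun _ => 0%C) (fun _ => 0).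
Proof. intros n _. rewrite Cmod_0. lra. Qed.

(** Comparison with the zero sequence, whose terms vanish because the last factor is always present,
    even for an empty tuple. *)
Lemma cterm_le (y : R) (a : list Z -> C) (b : list Z -> R)
    (N : nat) (n : list Z) (ts : list (list Z)) :
  0 <= y -> majorized y a b -> length n = nu -> In ts (tups N) ->
  Cmod (cterm a n ts) <= rterm b n ts * exp (- y * zl1 n).
Proof.
  intros Hy Ha Hn Hts.
  assert (H := cterm_diff_le y a (fun _ => 0%C) b (fun _ => 0) N n ts Hy Ha
                 (majorized_zero y)).
  unfold cterm at 2, rterm at 2 in H.
  rewrite Cmult_0_r, Rmult_0_r, Rminus_0_r in H.
  replace (cterm a n ts - 0)%C with (cterm a n ts) in H by ring.
  apply H; auto. intros m Hm.
  replace (a m - 0)%C with (a m) by ring. rewrite Rminus_0_r. auto.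
Qed.

Lemma cprod_RtoC (b : list Z -> R) (l : list (list Z)) :
  cprod (fun v => RtoC (b v)) l = RtoC (rprod b l).
Proof.
  unfold cprod, rprod. induction l as [|v l IH]; simpl; [reflexivity|].
  rewrite IH, RtoC_mult. reflexivity.
Qed.

Lemma cterm_RtoC (b : list Z -> R) (n : list Z) (ts : list (list Z)) :
  cterm (fun v => RtoC (b v)) n ts = RtoC (rterm b n ts).
Proof. unfold cterm, rterm. rewrite cprod_RtoC, RtoC_mult. reflexivity. Qed.

Lemma rsum_rprod_tuples (b : list Z -> R) (N m : nat) :
  rsum (rprod b) (tuples N nu m) = rsum b (box N nu) ^ m.
Proof.
  induction m as [|m IH].
  - unfold rsum, rprod. simpl. ring.
  - simpl tuples. rewrite rsum_flat_map.
    rewrite (rsum_ext _ (fun ts => rsum b (box N nu) * rprod b ts)).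
    + rewrite rsum_scal, IH. reflexivity.
    + intros ts _. rewrite rsum_map, Rmult_comm, <- rsum_scal. apply rsum_ext.
      intros v _. unfold rprod. simpl. ring.
Qed.

Lemma csum_cprod_tuples (a : list Z -> C) (N m : nat) :
  csum (cprod a) (tuples N nu m) = Defs.Cpow (csum a (box N nu)) m.
Proof.
  induction m as [|m IH].
  - unfold csum, lsum, cprod. simpl. ring.
  - simpl tuples. rewrite csum_flat_map.
    rewrite (csum_ext _ (fun ts => csum a (box N nu) * cprod a ts)%C).
    + rewrite csum_scal, IH. reflexivity.
    + intros ts _. rewrite csum_map, Cmult_comm, <- csum_scal. apply csum_ext.
      intros v _. unfold cprod. simpl. ring.
Qed.

Section Majorant.
Variables (b : list Z -> R) (S : R).
Hypothesis Hb : summable boxes b S.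

Lemma summable_const_ge0 : 0 <= S.
Proof.
  eapply Rle_trans; [|apply (smb_le _ _ _ Hb 0)].
  apply rsum_ge0. apply (smb_ge0 _ _ _ Hb).
Qed.

Lemma rprod_tups_ge0 (N : nat) (ts : list (list Z)) : In ts (tups N) -> 0 <= rprod b ts.
Proof.
  intros Hts. apply rprod_ge0. intros v Hv. apply (summable_boxes_ge0 b S v Hb).
  apply In_tups_length in Hts. rewrite Forall_forall in Hts. auto.
Qed.

Lemma summable_rprod : summable tups (rprod b) (S ^ (p - 1)).
Proof.
  split.
  - apply rprod_tups_ge0.
  - intros N. unfold tups. rewrite rsum_rprod_tuples. apply pow_incr. split.
    + apply rsum_ge0. apply (smb_ge0 _ _ _ Hb N).
    + apply (smb_le _ _ _ Hb N).
Qed.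

Lemma pow_p (x : R) : x * x ^ (p - 1) = x ^ p.
Proof. rewrite tech_pow_Rmult. f_equal. lia. Qed.

(** For fixed [n] the last factor is at most [S], while the products of the other [p - 1] factors,
    whose indices are free, sum to at most [S ^ (p - 1)]. *)
Lemma summable_rterm (n : list Z) : length n = nu -> summable tups (rterm b n) (S ^ p).
Proof.
  intros Hn. rewrite <- pow_p.
  apply summable_le with (u := fun ts => S * rprod b ts).
  - intros N ts Hts. pose proof (rprod_tups_ge0 N ts Hts).
    pose proof (length_last N n ts Hn Hts) as Hl.
    pose proof (summable_boxes_ge0 b S _ Hb Hl). pose proof (summable_boxes_elem b S _ Hb Hl).
    unfold rterm. split.
    + apply Rmult_le_pos; assumption.
    + rewrite Rmult_comm. apply Rmult_le_compat_r; assumption.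
  - apply summable_scal; [apply summable_const_ge0 | apply summable_rprod].
Qed.

Lemma majorized_dominated (y : R) (a : list Z -> C) (n : list Z) :
  0 <= y -> majorized y a b -> length n = nu ->
  dominated tups (cterm a n) (rterm b n).
Proof.
  intros Hy Ha Hn N ts Hts.
  eapply Rle_trans; [apply (cterm_le y a b N n ts); assumption|].
  rewrite <- (Rmult_1_r (rterm b n ts)) at 2. apply Rmult_le_compat_l.
  - apply (smb_ge0 _ _ _ (summable_rterm n Hn) N ts Hts).
  - rewrite <- exp_0. pose proof (zl1_ge0 n).
    apply exp_le_compat. nra.
Qed.

Lemma conv_correct (y : R) (a : list Z -> C) (n : list Z) :
  0 <= y -> majorized y a b -> length n = nu ->
  Ctends eventually (fun N => csum (cterm a n) (tups N)) (conv p nu a n).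
Proof.
  intros Hy Ha Hn.
  apply (limsum_correct _ tups_exhaustion (rterm b n) (S ^ p) (summable_rterm n Hn)).
  apply (majorized_dominated y); assumption.
Qed.

Lemma majorized_RtoC : majorized 0 (fun v => RtoC (b v)) b.
Proof.
  intros n Hn. rewrite Cmod_R, Rabs_pos_eq by (apply (summable_boxes_ge0 b S n Hb Hn)).
  replace (- 0 * zl1 n) with 0 by ring. rewrite exp_0. lra.
Qed.

Lemma conv_dominated_convergence {T : Type} (F : (T -> Prop) -> Prop) {FF : Filter F}
    (f : T -> list Z -> C) (g : list Z -> C) (n : list Z) :
  F (fun s => majorized 0 (f s) b) -> majorized 0 g b -> length n = nu ->
  (forall m, length m = nu -> Ctends F (fun s => f s m) (g m)) ->
  Ctends F (fun s => conv p nu (f s) n) (conv p nu g n).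
Proof.
  intros Hf Hg Hn Hc.
  apply (limsum_dominated_convergence _ tups_exhaustion (rterm b n) (S ^ p) (summable_rterm n Hn)
           F (fun s => cterm (f s) n) (cterm g n)).
  - generalize Hf. apply filter_imp. intros s Hs. apply (majorized_dominated 0); [lra|assumption..].
  - apply (majorized_dominated 0); [lra|assumption..].
  - intros N ts Hts. unfold cterm. apply Ctends_mult.
    + apply In_tups_length in Hts. clear - Hts Hc FF. unfold cprod.
      induction Hts as [|v ts Hv Hts IH]; simpl; [apply Ctends_const|].
      apply Ctends_mult; auto.
    + apply Hc. apply (length_last N); assumption.
Qed.

End Majorant.

(** The convolution power of a real sequence, read off the complex one so that a single theory of
    [conv] serves coefficients and majorants. *)
Definition rconv (b : list Z -> R) (n : list Z) : R := fst (conv p nu (fun v => RtoC (b v)) n).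

Lemma rconv_correct (b : list Z -> R) (S : R) (n : list Z) :
  summable boxes b S -> length n = nu ->
  filterlim (fun N => rsum (rterm b n) (tups N)) eventually (locally (rconv b n)).
Proof.
  intros Hb Hn.
  assert (H := conv_correct b S Hb 0 _ n (Rle_refl 0) (majorized_RtoC b S Hb) Hn).
  apply Ctends_fst in H.
  revert H. apply filterlim_ext. intros N.
  rewrite (csum_ext _ (fun ts => RtoC (rterm b n ts))) by (intros; apply cterm_RtoC).
  rewrite csum_RtoC. reflexivity.
Qed.

Lemma conv_diff_le (y : R) (a a' : list Z -> C) (b b' : list Z -> R) (S S' : R) (n : list Z) :
  0 <= y -> summable boxes b S -> summable boxes b' S' ->
  majorized y a b -> majorized y a' b' ->
  majorized y (fun n => a n - a' n)%C (fun n => b n - b' n) -> length n = nu ->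
  Cmod (conv p nu a n - conv p nu a' n) <= (rconv b n - rconv b' n) * exp (- y * zl1 n).
Proof.
  intros Hy Hb Hb' Ha Ha' Hd Hn.
  assert (H1 := Ctends_minus _ _ _ _ (conv_correct b S Hb y a n Hy Ha Hn)
                  (conv_correct b' S' Hb' y a' n Hy Ha' Hn)).
  assert (H2 : Ctends eventually
    (fun N => RtoC ((rsum (rterm b n) (tups N) - rsum (rterm b' n) (tups N)) * exp (- y * zl1 n)))
    (RtoC ((rconv b n - rconv b' n) * exp (- y * zl1 n)))).
  { apply Ctends_ext with (fun N => (RtoC (rsum (rterm b n) (tups N)) -
        RtoC (rsum (rterm b' n) (tups N))) * RtoC (exp (- y * zl1 n)))%C.
    - intros N. rewrite <- RtoC_minus, <- RtoC_mult. reflexivity.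
    - rewrite RtoC_mult, RtoC_minus. apply Ctends_mult; [|apply Ctends_const].
      apply Ctends_minus; apply Ctends_RtoC.
      + apply (rconv_correct b S n Hb Hn).
      + apply (rconv_correct b' S' n Hb' Hn). }
  (* If the inequality failed by a gap [d], a partial sum within [d / 2] of both limits would
     violate the termwise estimate. *)
  apply Rnot_lt_le. intros Hlt.
  set (d := Cmod (conv p nu a n - conv p nu a' n)
            - (rconv b n - rconv b' n) * exp (- y * zl1 n)).
  assert (He : 0 < d / 2) by (unfold d; lra).
  destruct (filter_ex _ (filter_and _ _ (H1 _ He) (H2 _ He))) as [N [A B]].
  rewrite <- RtoC_minus, Cmod_R in B. apply Rabs_def2 in B.
  assert (Hle : Cmod (csum (cterm a n) (tups N) - csum (cterm a' n) (tups N))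
    <= (rsum (rterm b n) (tups N) - rsum (rterm b' n) (tups N)) * exp (- y * zl1 n)).
  { rewrite <- csum_minus, Rmult_comm, <- rsum_minus, <- rsum_scal.
    apply Cmod_csum_le. intros ts Hts. rewrite Rmult_comm. apply (cterm_diff_le y a a' b b' N); auto. }
  assert (Ht : Cmod (conv p nu a n - conv p nu a' n) <=
     Cmod (csum (cterm a n) (tups N) - csum (cterm a' n) (tups N)) +
     Cmod (csum (cterm a n) (tups N) - csum (cterm a' n) (tups N) - (conv p nu a n - conv p nu a' n))).
  { rewrite Cmod_minus_sym with (a := (csum (cterm a n) (tups N) - csum (cterm a' n) (tups N))%C).
    eapply Rle_trans; [|apply Cmod_triangle]. right. f_equal. ring. }
  unfold d in *. lra.
Qed.

Lemma summable_zero {X : Type} (L : nat -> list X) : summable L (fun _ => 0) 0.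
Proof.
  split; [intros; lra|]. intros N. rewrite (rsum_ext _ (fun x => 0 * 0)) by (intros; ring).
  rewrite rsum_scal. lra.
Qed.

Lemma conv_zero (n : list Z) : conv p nu (fun _ => 0%C) n = 0%C.
Proof.
  apply Clim_correct. apply Ctends_ext with (fun _ => 0%C); [|apply Ctends_const].
  intros N. symmetry.
  change (csum (cterm (fun _ => 0%C) n) (tups N) = 0%C).
  rewrite (csum_ext _ (fun _ => 0 * 0)%C) by (intros; unfold cterm; ring).
  rewrite csum_scal. ring.
Qed.

Lemma conv_le (y : R) (a : list Z -> C) (b : list Z -> R) (S : R) (n : list Z) :
  0 <= y -> summable boxes b S -> majorized y a b -> length n = nu ->
  Cmod (conv p nu a n) <= rconv b n * exp (- y * zl1 n).
Proof.
  intros Hy Hb Ha Hn.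
  assert (H := conv_diff_le y a (fun _ => 0%C) b (fun _ => 0) S 0 n Hy Hb (summable_zero boxes)
                 Ha (majorized_zero y)).
  unfold rconv at 2 in H. rewrite !conv_zero in H. simpl fst in H.
  rewrite Rminus_0_r in H.
  replace (conv p nu a n - 0)%C with (conv p nu a n) in H by ring.
  apply H; auto. intros m Hm.
  replace (a m - 0)%C with (a m) by ring. rewrite Rminus_0_r. auto.
Qed.

(** The algebra property of $\ell^1$. On finite boxes the sums are exchanged: summing over [n] first
    gives a translated sum of [b], at most [S], and the free indices contribute [S ^ (p - 1)]. The
    box of tuples then grows. *)
Lemma summable_rconv (b : list Z -> R) (S : R) :
  summable boxes b S -> summable boxes (rconv b) (S ^ p).
Proof.
  intros Hb. split.
  - intros N n Hn. apply In_box_length in Hn.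
    assert (H := conv_le 0 _ b S n (Rle_refl 0) Hb (majorized_RtoC b S Hb) Hn).
    replace (- 0 * zl1 n) with 0 in H by ring. rewrite exp_0, Rmult_1_r in H.
    eapply Rle_trans; [apply Cmod_ge_0 | exact H].
  - intros N.
    assert (H : Ctends eventually
       (fun M => csum (fun n => RtoC (rsum (rterm b n) (tups M))) (box N nu))
       (csum (fun n => RtoC (rconv b n)) (box N nu))).
    { apply Ctends_csum; [apply eventually_filter|]. intros n Hn. apply Ctends_RtoC.
      apply (rconv_correct b S n Hb). apply (In_box_length _ _ _ Hn). }
    rewrite csum_RtoC in H. eapply Rle_trans; [apply Rle_abs|]. rewrite <- Cmod_R.
    apply (Ctends_le _ _ _ H). apply filter_forall. intros M.
    rewrite csum_RtoC, Cmod_R, Rabs_pos_eq.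
    + rewrite rsum_exchange.
      apply Rle_trans with (rsum (fun ts => S * rprod b ts) (tups M)).
      * apply rsum_le. intros ts Hts. unfold rterm. rewrite rsum_scal, Rmult_comm.
        apply Rmult_le_compat_r; [apply (rprod_tups_ge0 b S Hb M ts Hts)|].
        apply rsum_shift_le; [exact Hb|]. apply length_vsum. apply (In_tups_length M ts Hts).
      * rewrite rsum_scal, <- pow_p. apply Rmult_le_compat_l; [apply (summable_const_ge0 b S Hb)|].
        apply (smb_le _ _ _ (summable_rprod b S Hb)).
    + apply rsum_ge0. intros n Hn. apply rsum_ge0.
      apply (smb_ge0 _ _ _ (summable_rterm b S Hb n (In_box_length _ _ _ Hn)) M).
Qed.

Lemma Ctends_Cpow {T : Type} (F : (T -> Prop) -> Prop) {FF : Filter F} (f : T -> C) (z : C) (m : nat) :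
  Ctends F f z -> Ctends F (fun x => Defs.Cpow (f x) m) (Defs.Cpow z m).
Proof.
  intros H. induction m as [|m IH]; simpl; [apply Ctends_const|]. apply Ctends_mult; assumption.
Qed.

(* Summing over [n] first turns the last factor into a translated box sum, whose limit
   does not depend on the translation. *)
Lemma limsum_conv (a : list Z -> C) (b : list Z -> R) (S : R) :
  summable boxes b S -> majorized 0 a b ->
  limsum boxes (conv p nu a) = Defs.Cpow (limsum boxes a) p.
Proof.
  intros Hb Ha. set (U := limsum boxes a).
  assert (HS := summable_const_ge0 b S Hb).
  assert (Hdom : dominated boxes a b).
  { intros N n Hn. apply In_box_length in Hn. eapply Rle_trans; [apply Ha; exact Hn|].
    replace (- 0 * zl1 n) with 0 by ring. rewrite exp_0. lra. }
  assert (HU : Cmod U <= S) by (apply (limsum_bound _ boxes_exhaustion b S Hb a Hdom)).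
  assert (Hterm : forall N ts, In ts (tups N) -> Cmod (cprod a ts) <= rprod b ts).
  { intros N ts Hts. apply (cprod_diff_le a a b b). intros v Hv.
    apply In_tups_length in Hts. rewrite Forall_forall in Hts. specialize (Hts v Hv).
    destruct (In_box_ex nu v Hts) as [K HK]. pose proof (Hdom K v HK).
    replace (a v - a v)%C with (RtoC 0) by ring. rewrite Cmod_0. lra. }
  assert (Hsm : summable tups (fun ts => S * rprod b ts) (S * S ^ (p - 1)))
    by (apply summable_scal; [exact HS | apply (summable_rprod b S Hb)]).
  assert (Hprod : dominated tups (fun ts => U * cprod a ts)%C (fun ts => S * rprod b ts)).
  { intros N ts Hts. rewrite Cmod_mult.
    apply Rmult_le_compat; try apply Cmod_ge_0; [exact HU | apply (Hterm N ts Hts)]. }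
  assert (Hpow : limsum tups (fun ts => U * cprod a ts)%C = Defs.Cpow U p).
  { apply Clim_correct.
    apply Ctends_ext with (fun N => U * Defs.Cpow (csum a (box N nu)) (p - 1))%C.
    - intros N. unfold tups. rewrite csum_scal, csum_cprod_tuples. reflexivity.
    - replace (Defs.Cpow U p) with (U * Defs.Cpow U (p - 1))%C
        by (clear - Hp; destruct p as [|q]; [lia|]; simpl; rewrite Nat.sub_0_r; reflexivity).
      apply Ctends_scal. apply Ctends_Cpow; [apply eventually_filter|].
      apply (limsum_correct _ boxes_exhaustion b S Hb a Hdom). }
  rewrite <- Hpow. apply Clim_correct.
  (* The sum over [n] is finite at this stage, so it commutes with the limit over tuples; only the
     last factor of a tuple involves [n]. *)
  apply Ctends_ext with
    (fun N => limsum tups (fun ts => csum (fun n => a (vsub n (vsum nu ts))) (box N nu) * cprod a ts)%C).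
  - intros N. apply Clim_correct.
    apply Ctends_ext with (fun M => csum (fun n => csum (cterm a n) (tups M)) (box N nu)).
    + intros M. rewrite csum_exchange. apply csum_ext. intros ts _.
      unfold cterm. rewrite csum_scal. ring.
    + apply Ctends_csum; [apply eventually_filter|]. intros n Hn.
      apply (conv_correct b S Hb 0 a n (Rle_refl 0) Ha). apply (In_box_length _ _ _ Hn).
  - apply (limsum_dominated_convergence _ tups_exhaustion _ _ Hsm eventually
      (fun N ts => csum (fun n => a (vsub n (vsum nu ts))) (box N nu) * cprod a ts)%C
      (fun ts => U * cprod a ts)%C).
    + apply filter_forall. intros N M ts Hts. rewrite Cmod_mult.
      assert (Hv : length (vsum nu ts) = nu) by (apply length_vsum; apply (In_tups_length M ts Hts)).
      apply Rmult_le_compat; try apply Cmod_ge_0; [|apply (Hterm M ts Hts)].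
      eapply Rle_trans; [|apply (rsum_shift_le b S (vsum nu ts) N Hb Hv)].
      apply Cmod_csum_le. intros n Hn.
      assert (Hl : length (vsub n (vsum nu ts)) = nu)
        by (apply length_vsub; [apply (In_box_length _ _ _ Hn) | exact Hv]).
      destruct (In_box_ex nu _ Hl) as [K HK]. apply (Hdom K _ HK).
    + exact Hprod.
    + intros M ts Hts. apply Ctends_mult; [|apply Ctends_const].
      apply (csum_shift_tends a b S); auto.
      apply length_vsum. apply (In_tups_length M ts Hts).
Qed.

Lemma cexp_plus (s t : R) : cexp (s + t) = (cexp s * cexp t)%C.
Proof.
  unfold cexp, Cmult. simpl. rewrite cos_plus, sin_plus. f_equal. ring.
Qed.

Lemma cprod_modulate (a : list Z -> C) (th : list Z -> R) (l : list (list Z)) :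
  cprod (fun n => a n * cexp (th n))%C l = (cexp (rsum th l) * cprod a l)%C.
Proof.
  unfold cprod, rsum. induction l as [|v l IH]; simpl.
  - unfold cexp. rewrite cos_0, sin_0. change (1, 0) with (RtoC 1). ring.
  - rewrite IH, cexp_plus. ring.
Qed.

(** The character $n\mapsto e^{i(n\cdot\omega)x}$ is multiplicative and the indices add up to [n],
    so all phases combine into one. With [limsum_conv] this turns the power of a Fourier series at
    [x] into the series of the convolution power. *)
Lemma conv_modulate (a : list Z -> C) (b : list Z -> R) (S : R) (w : list R) (x : R) (n : list Z) :
  summable boxes b S -> majorized 0 a b -> length n = nu ->
  conv p nu (fun m => a m * cexp (zdot m w * x))%C n = (conv p nu a n * cexp (zdot n w * x))%C.
Proof.
  intros Hb Ha Hn.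
  rewrite Cmult_comm. rewrite !conv_limsum.
  rewrite <- (limsum_scal _ tups_exhaustion (rterm b n) (S ^ p) (summable_rterm b S Hb n Hn)).
  - apply limsum_ext. intros N ts Hts. unfold cterm. rewrite cprod_modulate.
    pose proof (In_tups_length N ts Hts) as HF.
    pose proof (length_vsum nu ts HF) as Hv.
    assert (Hd : zdot n w = rsum (fun v => zdot v w) ts + zdot (vsub n (vsum nu ts)) w).
    { rewrite <- zdot_vsum with (nu := nu) by exact HF.
      rewrite <- (vsub_vadd n (vsum nu ts)) at 1 by congruence.
      rewrite zdot_vadd; [ring|]. rewrite (length_vsub nu); congruence. }
    rewrite Hd, Rmult_plus_distr_r, cexp_plus.
    replace (rsum (fun n0 => zdot n0 w * x) ts) with (rsum (fun v => zdot v w) ts * x).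
    + ring.
    + rewrite Rmult_comm, <- rsum_scal. apply rsum_ext. intros; ring.
  - apply (majorized_dominated b S Hb 0); [lra|assumption..].
Qed.

End Vectors.

(** * Calculus of complex-valued functions of a real variable *)

Lemma norm_C_R (z : C) : @norm R_AbsRing C_R_NormedModule z = Cmod z.
Proof.
  unfold norm; simpl. unfold prod_norm, Cmod, norm; simpl. unfold abs; simpl.
  f_equal. rewrite !Rmult_1_r, <- !Rabs_mult.
  rewrite !Rabs_pos_eq by nra. reflexivity.
Qed.

Lemma scal_C_R (k : R) (z : C) : @scal R_Ring C_R_NormedModule k z = (RtoC k * z)%C.
Proof.
  destruct z as [a b]. unfold scal; simpl. unfold prod_scal, scal, Cmult; simpl.
  unfold mult; simpl. f_equal; ring.
Qed.

Lemma RtoC_mult_inv (h : R) : h <> 0 -> (RtoC h * RtoC (/ h))%C = 1%C.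
Proof. intros H. rewrite <- RtoC_mult, Rinv_r by exact H. reflexivity. Qed.

(** The derivative as a limit of quotients along the punctured filter, the form to which dominated
    convergence of series applies. *)
Definition Cderiv (f : R -> C) (x : R) (l : C) : Prop :=
  Ctends (locally' x) (fun y => RtoC (/ (y - x)) * (f y - f x))%C l.

Lemma Cderiv_is_derive (f : R -> C) (x : R) (l : C) :
  Cderiv f x l -> @is_derive R_AbsRing C_R_NormedModule f x l.
Proof.
  intros H. split.
  - apply (@is_linear_scal_l R_AbsRing C_R_NormedModule).
  - intros x' Hx'.
    assert (E : x = x') by (apply (is_filter_lim_locally_unique (K := R_AbsRing) (V := R_NormedModule)); exact Hx').
    subst x'. intros eps.
    generalize (H eps (cond_pos eps)). unfold locally', within.
    apply filter_imp. intros y Hy. rewrite norm_C_R.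
    (* The point [y = x], which the punctured filter ignores, belongs to the neighbourhood used by
       [is_derive]; both sides vanish there. *)
    destruct (Req_dec y x) as [->|Hne].
    + assert (E : minus (minus (f x) (f x)) (@scal R_Ring C_R_NormedModule (minus x x) l) = RtoC 0).
      { rewrite scal_C_R. change (f x - f x - RtoC (x - x) * l = 0)%C.
        rewrite Rminus_diag. ring. }
      eapply Rle_trans; [right; exact (f_equal Cmod E)|].
      rewrite Cmod_0. apply Rmult_le_pos; [apply Rlt_le, cond_pos | apply norm_ge_0].
    + assert (E : minus (minus (f y) (f x)) (@scal R_Ring C_R_NormedModule (minus y x) l)
                  = (RtoC (y - x) * (RtoC (/ (y - x)) * (f y - f x) - l))%C).
      { rewrite scal_C_R. change (f y - f x - RtoC (y - x) * l =
          RtoC (y - x) * (RtoC (/ (y - x)) * (f y - f x) - l))%C.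
        replace (f y - f x)%C with (RtoC (y - x) * RtoC (/ (y - x)) * (f y - f x))%C at 1
          by (rewrite RtoC_mult_inv by lra; ring).
        ring. }
      eapply Rle_trans; [right; exact (f_equal Cmod E)|].
      rewrite Cmod_mult, Cmod_R, Rmult_comm.
      change (norm (minus y x)) with (Rabs (y - x)).
      apply Rmult_le_compat_r; [apply Rabs_pos|]. apply Rlt_le, Hy. exact Hne.
Qed.

Lemma is_derive_Cderiv (f : R -> C) (x : R) (l : C) :
  @is_derive R_AbsRing C_R_NormedModule f x l -> Cderiv f x l.
Proof.
  intros [_ H] eps He.
  assert (Hh : 0 < eps / 2) by lra.
  specialize (H x (fun P HP => HP) (mkposreal _ Hh)). unfold locally', within.
  revert H. apply filter_imp. intros y Hy Hne. rewrite norm_C_R in Hy.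
  assert (E : minus (minus (f y) (f x)) (@scal R_Ring C_R_NormedModule (minus y x) l)
              = (RtoC (y - x) * (RtoC (/ (y - x)) * (f y - f x) - l))%C).
  { rewrite scal_C_R. change (f y - f x - RtoC (y - x) * l =
      RtoC (y - x) * (RtoC (/ (y - x)) * (f y - f x) - l))%C.
    replace (f y - f x)%C with (RtoC (y - x) * RtoC (/ (y - x)) * (f y - f x))%C at 1
      by (rewrite RtoC_mult_inv by lra; ring).
    ring. }
  apply (Rle_trans _ _ _ (Req_le _ _ (eq_sym (f_equal Cmod E)))) in Hy.
  rewrite Cmod_mult, Cmod_R, Rmult_comm in Hy.
  change (norm (minus y x)) with (Rabs (y - x)) in Hy. simpl in Hy.
  apply Rmult_le_reg_r in Hy; [lra|]. apply Rabs_pos_lt. lra.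
Qed.

Lemma locally'_R_proper (x : R) : ProperFilter (locally' x).
Proof.
  split; [|apply locally'_filter].
  intros P [eps HP]. exists (x + eps / 2). pose proof (cond_pos eps). apply HP; [|lra].
  change (Rabs (x + eps / 2 - x) < eps). rewrite Rabs_pos_eq; lra.
Qed.

Lemma Cderiv_unique (f : R -> C) (x : R) (l l' : C) : Cderiv f x l -> Cderiv f x l' -> l = l'.
Proof. apply (Ctends_unique (FF := locally'_R_proper x)). Qed.

Lemma filterlim_minus_locally' (x : R) : filterlim (fun y => y - x) (locally' x) (locally 0).
Proof.
  intros P [eps HP]. exists eps. intros y Hy _. apply HP.
  change (Rabs (y - x - 0) < eps). rewrite Rminus_0_r. exact Hy.
Qed.

Lemma Cderiv_continuous' (f : R -> C) (x : R) (l : C) : Cderiv f x l -> Ctends (locally' x) f (f x).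
Proof.
  intros H.
  assert (H2 := Ctends_plus _ _ _ _ (Ctends_const (f x))
    (Ctends_mult _ _ _ _ (Ctends_RtoC _ _ (filterlim_minus_locally' x)) H)).
  replace (f x + RtoC 0 * l)%C with (f x) in H2 by ring.
  revert H2. apply Ctends_ext_loc. unfold locally', within. apply filter_forall.
  intros y Hne. rewrite Cmult_assoc, RtoC_mult_inv by lra. ring.
Qed.

Lemma Cderiv_continuous (f : R -> C) (x : R) (l : C) : Cderiv f x l -> Ctends (locally x) f (f x).
Proof.
  intros H eps He. generalize (Cderiv_continuous' f x l H eps He).
  unfold locally', within. apply filter_imp. intros y Hy.
  destruct (Req_dec y x) as [->|Hne]; [|auto].
  replace (f x - f x)%C with (RtoC 0) by ring. rewrite Cmod_0. exact He.
Qed.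

Lemma Cderiv_const (z : C) (x : R) : Cderiv (fun _ => z) x 0%C.
Proof.
  unfold Cderiv. apply Ctends_ext with (fun _ => 0%C); [|apply Ctends_const].
  intros y. ring.
Qed.

Lemma Cderiv_mult (f g : R -> C) (x : R) (l m : C) :
  Cderiv f x l -> Cderiv g x m -> Cderiv (fun y => f y * g y)%C x (l * g x + f x * m)%C.
Proof.
  intros Hf Hg. pose proof (Cderiv_continuous' g x m Hg) as Hc.
  assert (H := Ctends_plus _ _ _ _ (Ctends_mult _ _ _ _ Hf Hc) (Ctends_scal (f x) _ _ Hg)).
  revert H. apply Ctends_ext. intros y. ring.
Qed.

Lemma Cderiv_minus (f g : R -> C) (x : R) (l m : C) :
  Cderiv f x l -> Cderiv g x m -> Cderiv (fun y => f y - g y)%C x (l - m)%C.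
Proof.
  intros Hf Hg. generalize (Ctends_minus _ _ _ _ Hf Hg). apply Ctends_ext. intros y. ring.
Qed.

Lemma Cderiv_ext (f g : R -> C) (x : R) (l : C) :
  (forall y, f y = g y) -> Cderiv f x l -> Cderiv g x l.
Proof. intros H. apply Ctends_ext. intros y. rewrite !H. reflexivity. Qed.

Lemma Cderiv_Cpow (f : R -> C) (x : R) (l : C) (m : nat) :
  Cderiv f x l ->
  Cderiv (fun y => Defs.Cpow (f y) m) x (RtoC (INR m) * Defs.Cpow (f x) (m - 1) * l)%C.
Proof.
  intros H. induction m as [|m IH].
  (* For exponent zero the truncated [0 - 1] is [0], and the factor [INR 0] makes the formula
     correct. *)
  - simpl. replace (0 * 1 * l)%C with (RtoC 0) by ring. apply Cderiv_const.
  - generalize (Cderiv_mult _ _ _ _ _ H IH). simpl Defs.Cpow.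
    replace (l * Defs.Cpow (f x) m + f x * (INR m * Defs.Cpow (f x) (m - 1) * l))%C
      with (RtoC (INR (S m)) * Defs.Cpow (f x) (S m - 1) * l)%C; [tauto|].
    rewrite S_INR, RtoC_plus. simpl (S m - 1)%nat. rewrite Nat.sub_0_r.
    destruct m as [|m].
    + simpl. ring.
    + replace (S m - 1)%nat with m by lia. simpl Defs.Cpow. ring.
Qed.

Lemma Cmod_cexp (t : R) : Cmod (cexp t) = 1.
Proof.
  unfold Cmod, cexp. simpl. rewrite !Rmult_1_r.
  replace (cos t * cos t + sin t * sin t) with 1; [apply sqrt_1|].
  generalize (sin2_cos2 t). unfold Rsqr. lra.
Qed.

Lemma cexp_0 : cexp 0 = 1%C.
Proof. unfold cexp. rewrite cos_0, sin_0. reflexivity. Qed.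

Lemma is_derive_pair (f g : R -> R) (x a b : R) :
  is_derive f x a -> is_derive g x b -> Cderiv (fun y => (f y, g y)) x (a, b).
Proof.
  assert (Hq : forall (h : R -> R) l, is_derive h x l ->
            filterlim (fun y => / (y - x) * (h y - h x)) (locally' x) (locally l)).
  { intros h l Hh. apply is_derive_Reals in Hh. intros P [eps HP].
    destruct (Hh eps (cond_pos eps)) as [d Hd]. exists d. intros y Hy Hne.
    apply HP. change (Rabs (/ (y - x) * (h y - h x) - l) < eps).
    assert (Hyx : y - x <> 0) by lra.
    specialize (Hd (y - x) Hyx Hy). rewrite Rplus_minus in Hd.
    rewrite Rmult_comm. exact Hd. }
  intros Hf Hg.
  assert (H := Ctends_plus _ _ _ _ (Ctends_RtoC _ _ (Hq f a Hf))
     (Ctends_scal Ci _ _ (Ctends_RtoC _ _ (Hq g b Hg)))).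
  replace (RtoC a + Ci * RtoC b)%C with (a, b) in H
    by (unfold RtoC, Ci, Cplus, Cmult; simpl; f_equal; ring).
  revert H. apply Ctends_ext. intros y.
  unfold RtoC, Ci, Cplus, Cmult, Cminus, Copp, Cplus; simpl. f_equal; ring.
Qed.

Lemma Cderiv_cexp (k x : R) : Cderiv (fun y => cexp (k * y)) x (Ci * RtoC k * cexp (k * x))%C.
Proof.
  replace (Ci * RtoC k * cexp (k * x))%C with (- (k * sin (k * x)), k * cos (k * x))
    by (unfold RtoC, Ci, Cmult, cexp; simpl; f_equal; ring).
  apply is_derive_pair; auto_derive; trivial; ring.
Qed.

Lemma Ctends_cexp (k x : R) : Ctends (locally x) (fun y => cexp (k * y)) (cexp (k * x)).
Proof. apply (Cderiv_continuous _ _ _ (Cderiv_cexp k x)). Qed.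

(** Cosine and sine are 1-Lipschitz and are estimated separately, whence the factor 2; it reappears
    in the majorants of the difference quotients. *)
Lemma Cmod_cexp_diff (s t : R) : Cmod (cexp s - cexp t) <= 2 * Rabs (s - t).
Proof.
  assert (H : forall h dh : R -> R, (forall x, is_derive h x (dh x)) -> (forall x, Rabs (dh x) <= 1) ->
    Rabs (h s - h t) <= Rabs (s - t)).
  { intros h dh H1 H2. rewrite <- (Rmult_1_l (Rabs (s - t))).
    apply (bounded_variation h dh). intros x _. auto. }
  eapply Rle_trans; [apply Cmod_le_fst_snd|]. simpl.
  pose proof (H cos (fun x => - sin x)) as H1. pose proof (H sin cos) as H2.
  assert (Rabs (cos s - cos t) <= Rabs (s - t)).
  { apply H1; [intros x; auto_derive; trivial; ring|].
    intros x. rewrite Rabs_Ropp. apply Rabs_le. apply SIN_bound. }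
  assert (Rabs (sin s - sin t) <= Rabs (s - t)).
  { apply H2; [intros x; auto_derive; trivial; ring|]. intros x. apply Rabs_le. apply COS_bound. }
  unfold Rminus in *. lra.
Qed.

(** * Complex integrals *)

(** The integral treats [C] as a real normed module, where multiplication by a complex constant is
    not the scalar action; on components it is a real linear combination. *)
Lemma is_RInt_Cmult (k : C) (f : R -> C) (a b : R) (l : C) :
  @is_RInt C_R_NormedModule f a b l ->
  @is_RInt C_R_NormedModule (fun t => k * f t)%C a b (k * l)%C.
Proof.
  intros H.
  assert (H1 := is_RInt_fct_extend_fst (U := R_NormedModule) (V := R_NormedModule) f a b l H).
  assert (H2 := is_RInt_fct_extend_snd (U := R_NormedModule) (V := R_NormedModule) f a b l H).
  apply (is_RInt_fct_extend_pair (U := R_NormedModule) (V := R_NormedModule)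
    (fun t => (k * f t)%C) a b).
  - apply (is_RInt_ext (fun t => minus (scal (fst k) (fst (f t))) (scal (snd k) (snd (f t))))).
    + intros; reflexivity.
    + apply (is_RInt_minus (V := R_NormedModule)); apply (is_RInt_scal (V := R_NormedModule)); assumption.
  - apply (is_RInt_ext (fun t => plus (scal (fst k) (snd (f t))) (scal (snd k) (fst (f t))))).
    + intros; reflexivity.
    + apply (is_RInt_plus (V := R_NormedModule)); apply (is_RInt_scal (V := R_NormedModule)); assumption.
Qed.

Lemma continuous_Ctends (f : R -> C) (x : R) :
  Ctends (locally x) f (f x) <-> @continuous R_UniformSpace C_R_NormedModule f x.
Proof. symmetry. apply (Ctends_filterlim (locally x)). Qed.

(** * Picard iteration with a shrinking exponential weight *)

Lemma majorized_weaken (nu : nat) (y : R) (a : list Z -> C) (b : list Z -> R) (S : R) :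
  0 <= y -> summable (boxes nu) b S -> majorized nu y a b -> majorized nu 0 a b.
Proof.
  intros Hy Hb Ha n Hn. eapply Rle_trans; [apply Ha; exact Hn|].
  apply Rmult_le_compat_l; [apply (summable_boxes_ge0 nu b S n Hb Hn)|].
  pose proof (zl1_ge0 n).
  apply exp_le_compat. nra.
Qed.

Lemma locally_Rabs_lt (T t : R) : Rabs t < T -> locally t (fun tau => Rabs tau < T).
Proof.
  intros H. assert (He : 0 < T - Rabs t) by lra.
  exists (mkposreal _ He). intros y Hy. change (Rabs (y - t) < T - Rabs t) in Hy.
  replace y with ((y - t) + t) by ring. pose proof (Rabs_triang (y - t) t). lra.
Qed.

Section Picard.
Variables (p nu : nat) (w : list R) (c : list Z -> C).
Variables (b0 : list Z -> R) (y0 s t0 lam S0 M : R).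
Hypothesis Hp : (1 <= p)%nat.
Hypothesis Ht0 : 0 < t0.
Hypothesis Hlam : 0 <= lam.
Hypothesis Hs : rnorm w <= INR p * lam * s.

Definition wt (t : R) : R := y0 - s * t.

Hypothesis Hwt : forall t, 0 <= t < t0 -> 0 <= wt t.
Hypothesis Hs0 : 0 <= s.
Hypothesis Hb0 : summable (boxes nu) b0 S0.
Hypothesis Hc : majorized nu y0 c b0.
Hypothesis HM : S0 + lam * M ^ p <= M.
Hypothesis HSM : S0 <= M.

(* Continuity is stated for the even extension in time, so that it is two-sided at [t = 0]. *)
Record regular (a : R -> list Z -> C) (b : list Z -> R) : Prop := {
  reg_maj : forall t, 0 <= t < t0 -> majorized nu (wt t) (a t) b;
  reg_cont : forall n t, length n = nu -> Rabs t < t0 ->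
    Ctends (locally t) (fun tau => a (Rabs tau) n) (a (Rabs t) n)
}.

Definition duhamel (a : R -> list Z -> C) (t : R) (n : list Z) : C :=
  @RInt C_R_CompleteNormedModule
    (fun tau => Cmult (cexp ((zdot n w) ^ 3 * (t - tau))) (conv p nu (a tau) n)) 0 t.

Definition step (a : R -> list Z -> C) (t : R) (n : list Z) : C :=
  Cminus (Cmult (cexp ((zdot n w) ^ 3 * t)) (c n))
    (Cmult (Cmult Ci (RtoC (zdot n w / INR p))) (duhamel a t n)).

(** The Duhamel integrand after the phase $e^{i(n\cdot\omega)^3t}$ is taken out. It no longer
    depends on the upper limit [t], so the fundamental theorem of calculus applies to its
    primitive. *)
Definition profile (a : R -> list Z -> C) (n : list Z) (tau : R) : C :=
  Cmult (cexp (- (zdot n w) ^ 3 * tau)) (conv p nu (a (Rabs tau)) n).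

Definition profile_primitive (a : R -> list Z -> C) (n : list Z) (t : R) : C :=
  @RInt C_R_CompleteNormedModule (profile a n) 0 t.

Lemma Rabs_range (t : R) : Rabs t < t0 -> 0 <= Rabs t < t0.
Proof. intros H. split; [apply Rabs_pos | exact H]. Qed.

Section Regular.
Variables (a : R -> list Z -> C) (b : list Z -> R) (S : R).
Hypothesis Hb : summable (boxes nu) b S.
Hypothesis Ha : regular a b.

Lemma conv_continuous (n : list Z) (t : R) :
  length n = nu -> Rabs t < t0 ->
  Ctends (locally t) (fun tau => conv p nu (a (Rabs tau)) n) (conv p nu (a (Rabs t)) n).
Proof.
  intros Hn Ht.
  assert (Hmaj : forall tau, Rabs tau < t0 -> majorized nu 0 (a (Rabs tau)) b).
  { intros tau Htau. apply Rabs_range in Htau.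
    apply (majorized_weaken nu (wt (Rabs tau)) _ b S); auto. apply (reg_maj _ _ Ha); auto. }
  apply (conv_dominated_convergence nu p Hp b S Hb (locally t)
           (fun tau => a (Rabs tau)) (a (Rabs t)) n); auto.
  - generalize (locally_Rabs_lt t0 t Ht). apply filter_imp. exact Hmaj.
  - intros m Hm. apply (reg_cont _ _ Ha); assumption.
Qed.

Lemma profile_continuous (n : list Z) (t : R) :
  length n = nu -> Rabs t < t0 -> Ctends (locally t) (profile a n) (profile a n t).
Proof.
  intros Hn Ht. apply Ctends_mult; [apply Ctends_cexp | apply conv_continuous; assumption].
Qed.

Lemma profile_RInt (n : list Z) (t : R) :
  length n = nu -> Rabs t < t0 -> @is_RInt C_R_NormedModule (profile a n) 0 t (profile_primitive a n t).
Proof.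
  intros Hn Ht. apply (RInt_correct (V := C_R_CompleteNormedModule)).
  apply (ex_RInt_continuous (V := C_R_CompleteNormedModule)).
  intros z Hz. apply (continuous_Ctends (profile a n) z). apply profile_continuous; [exact Hn|].
  apply Rabs_def2 in Ht. revert Hz. unfold Rmin, Rmax.
  destruct (Rle_dec 0 t); intros; apply Rabs_def1; lra.
Qed.

Lemma primitive_Cderiv (n : list Z) (t : R) :
  length n = nu -> Rabs t < t0 -> Cderiv (profile_primitive a n) t (profile a n t).
Proof.
  intros Hn Ht. apply is_derive_Cderiv.
  apply (is_derive_RInt (V := C_R_NormedModule) (profile a n) (profile_primitive a n) 0 t).
  - generalize (locally_Rabs_lt t0 t Ht). apply filter_imp. intros tau Htau.
    apply profile_RInt; assumption.
  - apply (continuous_Ctends (profile a n) t). apply profile_continuous; assumption.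
Qed.

Lemma duhamel_RInt_primitive (n : list Z) (t : R) :
  length n = nu -> 0 <= t < t0 ->
  @is_RInt C_R_NormedModule
    (fun tau => Cmult (cexp ((zdot n w) ^ 3 * (t - tau))) (conv p nu (a tau) n)) 0 t
    (cexp ((zdot n w) ^ 3 * t) * profile_primitive a n t)%C.
Proof.
  intros Hn Ht.
  apply (is_RInt_ext (V := C_R_NormedModule)
    (fun tau => (cexp ((zdot n w) ^ 3 * t) * profile a n tau)%C)).
  - intros tau Htau. rewrite Rmin_left, Rmax_right in Htau by lra.
    unfold profile. rewrite Rabs_pos_eq by lra. rewrite Cmult_assoc, <- cexp_plus.
    f_equal. f_equal. ring.
  - apply is_RInt_Cmult. apply profile_RInt; [exact Hn|]. rewrite Rabs_pos_eq; lra.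
Qed.

Lemma duhamel_primitive (n : list Z) (t : R) :
  length n = nu -> 0 <= t < t0 ->
  duhamel a t n = (cexp ((zdot n w) ^ 3 * t) * profile_primitive a n t)%C.
Proof.
  intros Hn Ht. apply (is_RInt_unique (V := C_R_CompleteNormedModule)).
  apply duhamel_RInt_primitive; assumption.
Qed.

Lemma duhamel_correct (n : list Z) (t : R) :
  length n = nu -> 0 <= t < t0 ->
  @is_RInt C_R_NormedModule
    (fun tau => Cmult (cexp ((zdot n w) ^ 3 * (t - tau))) (conv p nu (a tau) n)) 0 t
    (duhamel a t n).
Proof.
  intros Hn Ht. rewrite duhamel_primitive by assumption. apply duhamel_RInt_primitive; assumption.
Qed.

Lemma step_primitive (n : list Z) (t : R) :
  length n = nu -> 0 <= t < t0 ->
  step a t n = (cexp ((zdot n w) ^ 3 * t) *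
                (c n - Ci * RtoC (zdot n w / INR p) * profile_primitive a n t))%C.
Proof. intros Hn Ht. unfold step. rewrite duhamel_primitive by assumption. ring. Qed.

Lemma step_continuous (n : list Z) (t : R) :
  length n = nu -> Rabs t < t0 ->
  Ctends (locally t) (fun tau => step a (Rabs tau) n) (step a (Rabs t) n).
Proof.
  intros Hn Ht.
  set (h := fun tau => (cexp ((zdot n w) ^ 3 * tau) *
                (c n - Ci * RtoC (zdot n w / INR p) * profile_primitive a n tau))%C).
  assert (Hh : Ctends (locally (Rabs t)) h (h (Rabs t))).
  { unfold h. apply Ctends_mult; [apply Ctends_cexp|].
    apply Ctends_minus; [apply Ctends_const|]. apply Ctends_scal.
    apply (Cderiv_continuous _ _ (profile a n (Rabs t))).
    apply primitive_Cderiv; [exact Hn|]. rewrite Rabs_Rabsolu. exact Ht. }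
  rewrite step_primitive; [|exact Hn|apply Rabs_range; exact Ht]. fold (h (Rabs t)).
  apply Ctends_ext_loc with (fun tau => h (Rabs tau)).
  - generalize (locally_Rabs_lt t0 t Ht). apply filter_imp. intros tau Htau.
    rewrite step_primitive; [reflexivity|exact Hn|apply Rabs_range; exact Htau].
  - apply (Ctends_comp (locally t) (locally (Rabs t)) Rabs h); [|exact Hh].
    apply continuous_Rabs.
Qed.

End Regular.

(* The frequency factor is absorbed by the decay rate [s] of the weight:
   [s |n| int_0^t exp (- wt tau |n|) dtau = exp (- wt t |n|) - exp (- wt 0 |n|)]. *)
Lemma weighted_integral_le (f : R -> C) (n : list Z) (t D : R) (I : C) :
  0 <= t < t0 -> 0 <= D -> @is_RInt C_R_NormedModule f 0 t I ->
  (forall tau, 0 <= tau <= t -> Cmod (f tau) <= D * exp (- wt tau * zl1 n)) ->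
  Cmod (Ci * RtoC (zdot n w / INR p) * I) <= lam * D * exp (- wt t * zl1 n).
Proof.
  intros Ht HD HI Hf.
  set (g := fun tau => D * exp (- wt tau * zl1 n)).
  assert (Hg : forall x, is_derive g x (s * zl1 n * g x)).
  { intros x. unfold g, wt. auto_derive; [trivial|]. unfold Rminus. ring. }
  assert (Hgc : forall x, continuous g x).
  { intros x. apply (ex_derive_continuous (K := R_AbsRing) (V := R_NormedModule)). exists (s * zl1 n * g x). apply Hg. }
  assert (Hex : ex_RInt g 0 t) by (apply (ex_RInt_continuous (V := R_CompleteNormedModule)); auto).
  destruct Hex as [G HG].
  assert (H1 : Cmod I <= G).
  { rewrite <- norm_C_R. apply (norm_RInt_le f g 0 t I G); auto; [lra|].
    intros x Hx. rewrite norm_C_R. apply Hf. exact Hx. }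
  assert (H2 : s * zl1 n * G = g t - g 0).
  { assert (Ha := is_RInt_scal g 0 t (s * zl1 n) G HG).
    assert (Hb : is_RInt (fun y => scal (s * zl1 n) (g y)) 0 t (minus (g t) (g 0))).
    { apply (is_RInt_derive (V := R_CompleteNormedModule) g).
      - intros x _. apply Hg.
      - intros x _. apply (continuous_scal_r (s * zl1 n) g x). apply Hgc. }
    apply (is_RInt_unique (V := R_CompleteNormedModule)) in Ha.
    apply (is_RInt_unique (V := R_CompleteNormedModule)) in Hb.
    exact (eq_trans (eq_sym Ha) Hb). }
  assert (Hg0 : 0 <= g 0) by (apply Rmult_le_pos; [exact HD | apply Rlt_le, exp_pos]).
  assert (HpR : 0 < INR p) by (apply lt_0_INR; lia).
  (* The relation [Hs] between $\lambda$ and $s$ enters here: it makes the frequency factor at most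
     $\lambda$ times the rate $s|n|$ at which [g] grows. *)
  assert (H3 : Rabs (zdot n w / INR p) <= lam * (s * zl1 n)).
  { unfold Rdiv. rewrite Rabs_mult, (Rabs_pos_eq (/ INR p)) by (apply Rlt_le, Rinv_0_lt_compat, HpR).
    apply Rmult_le_reg_r with (INR p); [exact HpR|].
    rewrite Rmult_assoc, Rinv_l, Rmult_1_r by lra.
    eapply Rle_trans; [apply zdot_le|]. pose proof (zl1_ge0 n).
    apply Rle_trans with (zl1 n * (INR p * lam * s)); [|right; ring].
    apply Rmult_le_compat_l; assumption. }
  rewrite !Cmod_mult, Cmod_Ci, Cmod_R, Rmult_1_l.
  apply Rle_trans with (lam * (s * zl1 n) * G).
  - apply Rmult_le_compat; auto; [apply Rabs_pos | apply Cmod_ge_0].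
  - replace (lam * (s * zl1 n) * G) with (lam * (s * zl1 n * G)) by ring. rewrite H2.
    rewrite Rmult_assoc. apply Rmult_le_compat_l; [exact Hlam|]. fold (g t). lra.
Qed.

(** The phase is unimodular and [wt t <= y0], so the bound on the initial data only becomes
    weaker. *)
Lemma free_majorized (t : R) :
  0 <= t < t0 -> majorized nu (wt t) (fun n => cexp ((zdot n w) ^ 3 * t) * c n)%C b0.
Proof.
  intros Ht n Hn. rewrite Cmod_mult, Cmod_cexp, Rmult_1_l.
  eapply Rle_trans; [apply Hc; exact Hn|].
  apply Rmult_le_compat_l; [apply (summable_boxes_ge0 nu b0 S0 n Hb0 Hn)|].
  pose proof (zl1_ge0 n). unfold wt.
  apply exp_le_compat.
  assert (0 <= s * t) by (apply Rmult_le_pos; lra). nra.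
Qed.

Lemma duhamel_term_le (a : R -> list Z -> C) (b : list Z -> R) (S t : R) (n : list Z) :
  summable (boxes nu) b S -> regular a b -> 0 <= t < t0 -> length n = nu ->
  Cmod (Ci * RtoC (zdot n w / INR p) * duhamel a t n)
  <= lam * rconv nu p b n * exp (- wt t * zl1 n).
Proof.
  intros Hb Ha Ht Hn. eapply weighted_integral_le; [exact Ht| |apply (duhamel_correct a b S); assumption|].
  - apply (summable_boxes_ge0 nu _ (S ^ p)); [|exact Hn]. apply summable_rconv; assumption.
  - intros tau Htau. cbv beta. rewrite Cmod_mult, Cmod_cexp, Rmult_1_l.
    assert (Htau' : 0 <= tau < t0) by lra.
    apply (conv_le nu p Hp (wt tau) (a tau) b S n); auto. apply (reg_maj _ _ Ha tau Htau').
Qed.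

Lemma step_majorized (a : R -> list Z -> C) (b : list Z -> R) (S t : R) :
  summable (boxes nu) b S -> regular a b -> 0 <= t < t0 ->
  majorized nu (wt t) (step a t) (fun n => b0 n + lam * rconv nu p b n).
Proof.
  intros Hb Ha Ht n Hn. unfold step, Cminus.
  eapply Rle_trans; [apply Cmod_triangle|]. rewrite Cmod_opp, Rmult_plus_distr_r.
  apply Rplus_le_compat.
  - apply (free_majorized t Ht n Hn).
  - apply (duhamel_term_le a b S); assumption.
Qed.

Lemma step_regular (a : R -> list Z -> C) (b : list Z -> R) (S : R) :
  summable (boxes nu) b S -> regular a b ->
  regular (step a) (fun n => b0 n + lam * rconv nu p b n).
Proof.
  intros Hb Ha. split.
  - intros t Ht. apply (step_majorized a b S); assumption.
  - intros n t Hn Ht. apply (step_continuous a b S); assumption.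
Qed.

(** The free terms cancel, and what remains is the Duhamel integral of a difference of convolutions.
    The resulting bound has the form of a difference of two consecutive majorants, so inductions on
    the iterates close. *)
Lemma step_diff_majorized (a a' : R -> list Z -> C) (b b' : list Z -> R) (S S' t : R) :
  summable (boxes nu) b S -> summable (boxes nu) b' S' -> regular a b -> regular a' b' ->
  (forall t, 0 <= t < t0 -> majorized nu (wt t) (fun n => a t n - a' t n)%C (fun n => b n - b' n)) ->
  0 <= t < t0 ->
  majorized nu (wt t) (fun n => step a t n - step a' t n)%C
    (fun n => lam * (rconv nu p b n - rconv nu p b' n)).
Proof.
  intros Hb Hb' Ha Ha' Hd Ht n Hn.
  replace (step a t n - step a' t n)%C
    with (- (Ci * RtoC (zdot n w / INR p) * (duhamel a t n - duhamel a' t n)))%C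
    by (unfold step; ring).
  rewrite Cmod_opp.
  assert (Hconv : forall tau, 0 <= tau < t0 ->
    Cmod (conv p nu (a tau) n - conv p nu (a' tau) n)
    <= (rconv nu p b n - rconv nu p b' n) * exp (- wt tau * zl1 n)).
  { intros tau Htau. apply (conv_diff_le nu p Hp (wt tau) _ _ b b' S S' n); auto.
    - apply (reg_maj _ _ Ha tau Htau).
    - apply (reg_maj _ _ Ha' tau Htau). }
  apply weighted_integral_le with (f := fun tau =>
    (cexp ((zdot n w) ^ 3 * (t - tau)) * (conv p nu (a tau) n - conv p nu (a' tau) n))%C).
  - exact Ht.
  (* The majorant difference is nonnegative because, times a positive exponential, it bounds a
     modulus. *)
  - assert (H := Hconv t Ht). pose proof (exp_pos (- wt t * zl1 n)).
    pose proof (Cmod_ge_0 (conv p nu (a t) n - conv p nu (a' t) n)). nra.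
  - apply (is_RInt_ext (V := C_R_NormedModule) (fun tau => minus
       (cexp ((zdot n w) ^ 3 * (t - tau)) * conv p nu (a tau) n : C_R_NormedModule)%C
       (cexp ((zdot n w) ^ 3 * (t - tau)) * conv p nu (a' tau) n : C_R_NormedModule)%C)).
    + intros tau _.
      change (cexp ((zdot n w) ^ 3 * (t - tau)) * conv p nu (a tau) n
              - cexp ((zdot n w) ^ 3 * (t - tau)) * conv p nu (a' tau) n =
              cexp ((zdot n w) ^ 3 * (t - tau)) * (conv p nu (a tau) n - conv p nu (a' tau) n))%C.
      ring.
    + apply (is_RInt_minus (V := C_R_NormedModule)).
      * apply (duhamel_correct a b S); assumption.
      * apply (duhamel_correct a' b' S'); assumption.
  - intros tau Htau. cbv beta. rewrite Cmod_mult, Cmod_cexp, Rmult_1_l. apply Hconv. lra.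
Qed.

(** * Scalar majorants and convergence of the iterates *)

Fixpoint majorant (k : nat) (n : list Z) : R :=
  match k with
  | O => b0 n
  | S k => b0 n + lam * rconv nu p (majorant k) n
  end.

Notation iter := (picard p nu w c).

Lemma summable_plus {X : Type} (L : nat -> list X) (u v : X -> R) (S S' : R) :
  summable L u S -> summable L v S' -> summable L (fun x => u x + v x) (S + S').
Proof.
  intros [H1 H2] [H3 H4]. split.
  - intros N x Hx. apply Rplus_le_le_0_compat; [apply (H1 N) | apply (H3 N)]; exact Hx.
  - intros N. rewrite rsum_plus. apply Rplus_le_compat; auto.
Qed.

Lemma summable_majorant (k : nat) : summable (boxes nu) (majorant k) M.
Proof.
  induction k as [|k IH].
  - destruct Hb0 as [H1 H2]. split; [exact H1|]. intros N. specialize (H2 N). change (rsum b0 (boxes nu N) <= M). lra.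
  - assert (H := summable_plus _ _ _ _ _ Hb0
       (summable_scal _ _ _ lam Hlam (summable_rconv nu p Hp _ _ IH))).
    destruct H as [H1 H2]. split; [exact H1|]. intros N. apply Rle_trans with (2 := HM). exact (H2 N).
Qed.

Lemma iter_regular (k : nat) : regular (iter k) (majorant k).
Proof.
  induction k as [|k IH].
  - split.
    + intros t Ht. apply (free_majorized t Ht).
    + intros n t Hn Ht. simpl. apply Ctends_mult; [|apply Ctends_const].
      apply (Ctends_comp (locally t) (locally (Rabs t)) Rabs
               (fun y => cexp (zdot n w * (zdot n w * (zdot n w * 1)) * y))); [apply continuous_Rabs|].
      apply Ctends_cexp.
  - apply (step_regular (iter k) (majorant k) M); [apply summable_majorant | exact IH].
Qed.

(** The first increment is a bare Duhamel term, as [majorant 1 - majorant 0] is the bare term with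
    [lam]. Later increments obey the recursion that the majorant increments obey. *)
Lemma iter_diff_step (k : nat) (t : R) :
  0 <= t < t0 ->
  majorized nu (wt t) (fun n => iter (S k) t n - iter k t n)%C
    (fun n => majorant (S k) n - majorant k n).
Proof.
  revert t. induction k as [|k IH]; intros t Ht.
  - intros n Hn.
    replace (iter 1 t n - iter 0 t n)%C
      with (- (Ci * RtoC (zdot n w / INR p) * duhamel (iter 0) t n))%C
      by (change (iter 1 t n) with (step (iter 0) t n);
          change (iter 0 t n) with (cexp ((zdot n w) ^ 3 * t) * c n)%C; unfold step; ring).
    rewrite Cmod_opp.
    replace (majorant 1 n - majorant 0 n) with (lam * rconv nu p b0 n)
      by (change (majorant 1 n) with (b0 n + lam * rconv nu p b0 n);
          change (majorant 0 n) with (b0 n); ring).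
    apply (duhamel_term_le (iter 0) b0 S0); [exact Hb0 | apply iter_regular | assumption..].
  - intros n Hn.
    replace (majorant (S (S k)) n - majorant (S k) n)
      with (lam * (rconv nu p (majorant (S k)) n - rconv nu p (majorant k) n))
      by (simpl majorant; ring).
    apply (step_diff_majorized (iter (S k)) (iter k) (majorant (S k)) (majorant k) M M t); auto.
    + apply summable_majorant.
    + apply summable_majorant.
    + apply iter_regular.
    + apply iter_regular.
Qed.

(** Read off at time zero: the increment, times a positive exponential, bounds the modulus of a
    difference of iterates. *)
Lemma majorant_incr (k : nat) (n : list Z) : length n = nu -> majorant k n <= majorant (S k) n.
Proof.
  intros Hn. assert (H := iter_diff_step k 0 (conj (Rle_refl 0) Ht0) n Hn). cbv beta in H.
  pose proof (Cmod_ge_0 (iter (S k) 0 n - iter k 0 n)).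
  pose proof (exp_pos (- wt 0 * zl1 n)). nra.
Qed.

Lemma iter_diff (k j : nat) (t : R) :
  0 <= t < t0 ->
  majorized nu (wt t) (fun n => iter (k + j) t n - iter k t n)%C
    (fun n => majorant (k + j) n - majorant k n).
Proof.
  intros Ht n Hn. induction j as [|j IH].
  - rewrite Nat.add_0_r. replace (iter k t n - iter k t n)%C with (RtoC 0) by ring.
    rewrite Cmod_0. lra.
  - rewrite Nat.add_succ_r.
    replace (iter (S (k + j)) t n - iter k t n)%C
      with ((iter (S (k + j)) t n - iter (k + j) t n) + (iter (k + j) t n - iter k t n))%C by ring.
    eapply Rle_trans; [apply Cmod_triangle|].
    assert (H := iter_diff_step (k + j) t Ht n Hn). cbv beta in H. lra.
Qed.

Definition majorant_lim (n : list Z) : R := real (Lim_seq (fun k => majorant k n)).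

Lemma majorant_lim_correct (n : list Z) :
  length n = nu -> is_lim_seq (fun k => majorant k n) (majorant_lim n).
Proof.
  intros Hn. apply Lim_seq_correct'. apply (ex_finite_lim_seq_incr _ M).
  - intros k. apply majorant_incr. exact Hn.
  - intros k. apply (summable_boxes_elem nu _ M); [apply summable_majorant | exact Hn].
Qed.

Lemma majorant_le_lim (k : nat) (n : list Z) : length n = nu -> majorant k n <= majorant_lim n.
Proof.
  intros Hn. apply (is_lim_seq_incr_compare (fun k => majorant k n)).
  - apply majorant_lim_correct. exact Hn.
  - intros j. apply majorant_incr. exact Hn.
Qed.

(** On each finite box the sum commutes with the limit in [k], so the uniform bound [M] is
    inherited. *)
Lemma summable_majorant_lim : summable (boxes nu) majorant_lim M.
Proof.
  split.
  - intros N n Hn. apply In_box_length in Hn.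
    eapply Rle_trans; [|apply (majorant_le_lim 0 n Hn)].
    apply (summable_boxes_ge0 nu b0 S0 n Hb0 Hn).
  - intros N.
    assert (H : Ctends eventually (fun k => csum (fun n => RtoC (majorant k n)) (boxes nu N))
       (csum (fun n => RtoC (majorant_lim n)) (boxes nu N))).
    { apply (Ctends_csum eventually (fun k n => RtoC (majorant k n))).
      intros n Hn. apply Ctends_RtoC. apply majorant_lim_correct.
      apply (In_box_length _ _ _ Hn). }
    rewrite csum_RtoC in H. eapply Rle_trans; [apply Rle_abs|]. rewrite <- Cmod_R.
    apply (Ctends_le _ _ _ H). apply filter_forall. intros k.
    rewrite csum_RtoC, Cmod_R, Rabs_pos_eq.
    + apply (smb_le _ _ _ (summable_majorant k)).
    + apply rsum_ge0. apply (smb_ge0 _ _ _ (summable_majorant k) N).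
Qed.

Definition sol (t : R) (n : list Z) : C := Clim (fun k => iter k t n).

Lemma iter_tends (t : R) (n : list Z) :
  0 <= t < t0 -> length n = nu -> Ctends eventually (fun k => iter k t n) (sol t n).
Proof.
  intros Ht Hn. apply Clim_cauchy. intros eps He.
  assert (Hl := majorant_lim_correct n Hn). apply is_lim_seq_spec in Hl.
  destruct (Hl (mkposreal _ He)) as [N HN]. exists N. intros m Hm.
  specialize (HN N (Nat.le_refl N)). simpl in HN.
  replace m with (N + (m - N))%nat by lia.
  eapply Rle_lt_trans.
  - apply (majorized_weaken nu (wt t) (fun n => iter (N + (m - N)) t n - iter N t n)%C (fun n => majorant_lim n - majorant N n) M).
    + apply Hwt. exact Ht.
    + apply summable_le with (2 := summable_majorant_lim).
      intros K x Hx. apply In_box_length in Hx.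
      pose proof (majorant_le_lim N x Hx).
      pose proof (summable_boxes_ge0 nu _ M x (summable_majorant N) Hx). lra.
    + intros x Hx. eapply Rle_trans; [apply (iter_diff N (m - N) t Ht x Hx)|].
      apply Rmult_le_compat_r; [apply Rlt_le, exp_pos|].
      pose proof (majorant_le_lim (N + (m - N)) x Hx). lra.
    + exact Hn.
  - replace (- 0 * zl1 n) with 0 by ring. rewrite exp_0, Rmult_1_r.
    apply Rabs_def2 in HN. lra.
Qed.

(** The limit of [iter_diff] in its second index. Apart from a weight at most 1 the bound does not
    involve [t], so each coefficient converges uniformly in time and continuity survives in
    [sol_regular]. *)
Lemma sol_diff (k : nat) (t : R) :
  0 <= t < t0 ->
  majorized nu (wt t) (fun n => sol t n - iter k t n)%C (fun n => majorant_lim n - majorant k n).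
Proof.
  intros Ht n Hn.
  apply (Ctends_le (F := eventually) (fun j => iter j t n - iter k t n)%C).
  - apply Ctends_minus; [apply iter_tends; assumption | apply Ctends_const].
  - exists k. intros j Hj. replace j with (k + (j - k))%nat by lia.
    eapply Rle_trans; [apply (iter_diff k (j - k) t Ht n Hn)|].
    apply Rmult_le_compat_r; [apply Rlt_le, exp_pos|].
    pose proof (majorant_le_lim (k + (j - k)) n Hn). lra.
Qed.

Lemma sol_regular : regular sol majorant_lim.
Proof.
  split.
  - intros t Ht n Hn.
    replace (sol t n) with ((sol t n - iter 0 t n) + iter 0 t n)%C by ring.
    eapply Rle_trans; [apply Cmod_triangle|].
    pose proof (sol_diff 0 t Ht n Hn). pose proof (reg_maj _ _ (iter_regular 0) t Ht n Hn).
    cbv beta in *. lra.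
  - intros n t Hn Ht eps He.
    assert (He' : 0 < eps / 3) by lra.
    assert (Hl := majorant_lim_correct n Hn). apply is_lim_seq_spec in Hl.
    destruct (Hl (mkposreal _ He')) as [N HN].
    specialize (HN N (Nat.le_refl N)). simpl in HN. apply Rabs_def2 in HN.
    assert (Hclose : forall tau, Rabs tau < t0 ->
      Cmod (sol (Rabs tau) n - iter N (Rabs tau) n) < eps / 3).
    { intros tau Htau. apply Rabs_range in Htau.
      eapply Rle_lt_trans; [apply (sol_diff N _ Htau n Hn)|].
      assert (Hle : exp (- wt (Rabs tau) * zl1 n) <= 1).
      { rewrite <- exp_0. pose proof (zl1_ge0 n). pose proof (Hwt _ Htau).
        apply exp_le_compat. nra. }
      pose proof (majorant_le_lim N n Hn). pose proof (exp_pos (- wt (Rabs tau) * zl1 n)). nra. }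
    generalize (filter_and _ _ (locally_Rabs_lt t0 t Ht)
                  (reg_cont _ _ (iter_regular N) n t Hn Ht _ He')).
    apply filter_imp. intros tau [H1 H2].
    replace (sol (Rabs tau) n - sol (Rabs t) n)%C
      with ((sol (Rabs tau) n - iter N (Rabs tau) n)
            + (iter N (Rabs tau) n - iter N (Rabs t) n)
            + - (sol (Rabs t) n - iter N (Rabs t) n))%C by ring.
    eapply Rle_lt_trans; [apply Cmod_triangle|].
    eapply Rle_lt_trans; [apply Rplus_le_compat_r, Cmod_triangle|]. rewrite Cmod_opp.
    pose proof (Hclose tau H1). pose proof (Hclose t Ht). lra.
Qed.

(** The distance from [step sol] to the next iterate is controlled by the gap between [rconv] of the
    limit majorant and of the [k]-th one. That gap tends to zero by dominated convergence for real
    sequences, so no limit is passed under the complex integral. *)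
Lemma sol_fixed_point (t : R) (n : list Z) :
  0 <= t < t0 -> length n = nu -> sol t n = step sol t n.
Proof.
  intros Ht Hn.
  assert (Hstep : Ctends eventually (fun k => iter (S k) t n) (sol t n)).
  { apply (Ctends_comp eventually eventually S (fun k => iter k t n)); [|apply iter_tends; assumption].
    intros P [N HN]. exists N. intros k Hk. apply HN. lia. }
  apply (Ctends_unique _ _ _ Hstep).
  assert (Hrc : filterlim (fun k => rconv nu p (majorant k) n) eventually
                  (locally (rconv nu p majorant_lim n))).
  { apply Ctends_fst.
    apply (conv_dominated_convergence nu p Hp majorant_lim M summable_majorant_lim eventually
      (fun k v => RtoC (majorant k v)) (fun v => RtoC (majorant_lim v)) n).
    - apply filter_forall. intros k m Hm.
      rewrite Cmod_R, Rabs_pos_eq by (apply (summable_boxes_ge0 nu _ M m (summable_majorant k) Hm)).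
      replace (- 0 * zl1 m) with 0 by ring. rewrite exp_0, Rmult_1_r.
      apply majorant_le_lim. exact Hm.
    - apply (majorized_RtoC nu _ M). apply summable_majorant_lim.
    - exact Hn.
    - intros m Hm. apply Ctends_RtoC. apply majorant_lim_correct. exact Hm. }
  apply Ctends_squeeze with
    (g := fun k => lam * exp (- wt t * zl1 n) * (rconv nu p majorant_lim n - rconv nu p (majorant k) n)).
  - apply filter_forall. intros k. rewrite Cmod_minus_sym.
    change (iter (S k) t n) with (step (iter k) t n).
    eapply Rle_trans.
    + apply (step_diff_majorized sol (iter k) majorant_lim (majorant k) M M t); auto.
      * apply summable_majorant_lim.
      * apply summable_majorant.
      * apply sol_regular.
      * apply iter_regular.
      * intros tau Htau. apply sol_diff. exact Htau.
    + right. ring.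
  - assert (Hm := is_lim_seq_scal_l _ (lam * exp (- wt t * zl1 n)) _
      (is_lim_seq_minus' _ _ _ _ (is_lim_seq_const (rconv nu p majorant_lim n)) Hrc)).
    rewrite Rminus_diag in Hm. simpl Rbar_mult in Hm. rewrite Rmult_0_r in Hm. exact Hm.
Qed.

End Picard.

(** * Quasi-periodic Fourier series *)

Section Fourier.
Variables (nu : nat) (w : list R).

Definition fourier (d : list Z -> C) (x : R) : C :=
  limsum (boxes nu) (fun n => d n * cexp (zdot n w * x))%C.

Definition dcoef (d : list Z -> C) (n : list Z) : C := (Ci * RtoC (zdot n w) * d n)%C.

Definition bounded_by (d : list Z -> C) (v : list Z -> R) : Prop :=
  forall n, length n = nu -> Cmod (d n) <= v n.

Lemma fourier_dominated (d : list Z -> C) (v : list Z -> R) (x : R) :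
  bounded_by d v -> dominated (boxes nu) (fun n => d n * cexp (zdot n w * x))%C v.
Proof.
  intros Hd N n Hn. rewrite Cmod_mult, Cmod_cexp, Rmult_1_r. apply Hd.
  apply (In_box_length _ _ _ Hn).
Qed.

Variables (v : list Z -> R) (S : R).
Hypothesis Hv : summable (boxes nu) v S.

Lemma fourier_ext (d d' : list Z -> C) (x : R) :
  (forall n, length n = nu -> d n = d' n) -> fourier d x = fourier d' x.
Proof.
  intros H. apply limsum_ext. intros N n Hn. rewrite H; [reflexivity|].
  apply (In_box_length _ _ _ Hn).
Qed.

Lemma fourier_plus (d d' : list Z -> C) (x : R) :
  bounded_by d v -> bounded_by d' v ->
  fourier (fun n => d n + d' n)%C x = (fourier d x + fourier d' x)%C.
Proof.
  intros Hd Hd'. unfold fourier.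
  rewrite <- (limsum_plus _ (boxes_exhaustion nu) v v S S Hv Hv) by (apply fourier_dominated; assumption).
  apply limsum_ext. intros N n _. ring.
Qed.

Lemma fourier_scal (k : C) (d : list Z -> C) (x : R) :
  bounded_by d v -> fourier (fun n => k * d n)%C x = (k * fourier d x)%C.
Proof.
  intros Hd. unfold fourier.
  rewrite <- (limsum_scal _ (boxes_exhaustion nu) v S Hv) by (apply fourier_dominated; assumption).
  apply limsum_ext. intros N n _. ring.
Qed.

Lemma limsum_quotient (k : C) (f g : list Z -> C) :
  dominated (boxes nu) f v -> dominated (boxes nu) g v ->
  (k * (limsum (boxes nu) f - limsum (boxes nu) g))%C
  = limsum (boxes nu) (fun n => k * (f n - g n))%C.
Proof.
  intros Hf Hg. symmetry. apply Clim_correct.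
  apply Ctends_ext with (fun N => k * (csum f (boxes nu N) - csum g (boxes nu N)))%C.
  - intros N. rewrite csum_scal, csum_minus. reflexivity.
  - apply Ctends_scal. apply Ctends_minus;
      apply (limsum_correct _ (boxes_exhaustion nu) v S Hv); assumption.
Qed.

(** Every difference quotient of a mode is at most $2|n\cdot\omega||d(n)|$, uniformly in [y], and so
    is dominated by [2 * v]; the termwise limit is legitimate. *)
Lemma fourier_Cderiv (d : list Z -> C) (x : R) :
  bounded_by d v -> bounded_by (dcoef d) v -> Cderiv (fourier d) x (fourier (dcoef d) x).
Proof.
  intros Hd Hd'.
  assert (H2v : summable (boxes nu) (fun n => 2 * v n) (2 * S))
    by (apply summable_scal; [lra | exact Hv]).
  unfold Cderiv.
  apply Ctends_ext with (fun y => limsum (boxes nu) (fun n => RtoC (/ (y - x)) *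
     (d n * cexp (zdot n w * y) - d n * cexp (zdot n w * x)))%C).
  { intros y. symmetry. apply limsum_quotient; apply fourier_dominated; exact Hd. }
  apply (limsum_dominated_convergence _ (boxes_exhaustion nu) _ _ H2v (locally' x)
    (fun y n => RtoC (/ (y - x)) * (d n * cexp (zdot n w * y) - d n * cexp (zdot n w * x)))%C
    (fun n => dcoef d n * cexp (zdot n w * x))%C).
  - unfold locally', within. apply filter_forall. intros y Hne N n Hn.
    replace (d n * cexp (zdot n w * y) - d n * cexp (zdot n w * x))%C
      with (d n * (cexp (zdot n w * y) - cexp (zdot n w * x)))%C by ring.
    assert (Hyx : 0 < Rabs (y - x)) by (apply Rabs_pos_lt; lra).
    rewrite !Cmod_mult, Cmod_R, Rabs_inv.
    apply Rmult_le_reg_l with (Rabs (y - x)); [exact Hyx|].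
    rewrite <- Rmult_assoc, Rinv_r, Rmult_1_l by lra.
    assert (H1 := Cmod_cexp_diff (zdot n w * y) (zdot n w * x)).
    rewrite <- Rmult_minus_distr_l, Rabs_mult in H1.
    assert (H2 := Hd' n (In_box_length _ _ _ Hn)). unfold dcoef in H2.
    rewrite !Cmod_mult, Cmod_Ci, Cmod_R, Rmult_1_l in H2.
    pose proof (Cmod_ge_0 (d n)).
    apply Rle_trans with (Cmod (d n) * (2 * (Rabs (zdot n w) * Rabs (y - x)))).
    + apply Rmult_le_compat_l; assumption.
    + replace (Cmod (d n) * (2 * (Rabs (zdot n w) * Rabs (y - x))))
        with (Rabs (y - x) * (2 * (Rabs (zdot n w) * Cmod (d n)))) by ring.
      apply Rmult_le_compat_l; lra.
  - intros N n Hn. eapply Rle_trans; [apply (fourier_dominated _ v x Hd' N n Hn)|].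
    pose proof (smb_ge0 _ _ _ Hv N n Hn). lra.
  - intros N n Hn. generalize (Ctends_scal (d n) _ _ (Cderiv_cexp (zdot n w) x)).
    unfold dcoef.
    replace (d n * (Ci * zdot n w * cexp (zdot n w * x)))%C
      with (Ci * zdot n w * d n * cexp (zdot n w * x))%C by ring.
    apply Ctends_ext. intros y. ring.
Qed.

Lemma fourier_cont_on_strip (t0 : R) (d : R -> list Z -> C) (t x : R) :
  (forall t, Ico0 t0 t -> bounded_by (d t) v) -> Ico0 t0 t ->
  (forall n, length n = nu ->
     Ctends (within (Ico0 t0) (locally t)) (fun tau => d tau n) (d t n)) ->
  cont_on_strip t0 (fun t x => fourier (d t) x) t x.
Proof.
  intros Hd Ht Hc. unfold cont_on_strip.
  apply (Ctends_filterlim (within (fun q : R * R => Ico0 t0 (fst q)) (locally (t, x)))).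
  apply (limsum_dominated_convergence _ (boxes_exhaustion nu) v S Hv
    (within (fun q : R * R => Ico0 t0 (fst q)) (locally (t, x)))
    (fun q n => d (fst q) n * cexp (zdot n w * snd q))%C
    (fun n => d t n * cexp (zdot n w * x))%C).
  - unfold within. apply filter_forall. intros q Hq. apply fourier_dominated. apply Hd. exact Hq.
  - apply fourier_dominated. apply Hd. exact Ht.
  - intros N n Hn. apply Ctends_mult.
    + apply (Ctends_comp _ (within (Ico0 t0) (locally t)) fst (fun tau => d tau n)).
      * intros P [eps HP]. exists eps. intros q [Hq _] Hi. apply HP; assumption.
      * apply Hc. apply (In_box_length _ _ _ Hn).
    + apply (Ctends_comp _ (locally x) snd (fun y => cexp (zdot n w * y))).
      * intros P [eps HP]. exists eps. intros q [_ Hq] _. apply HP; assumption.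
      * apply Ctends_cexp.
Qed.

(** Differentiability of each coefficient gives no control that is uniform in [n]; the Lipschitz
    hypothesis with summable constants supplies the domination of the quotients. *)
Lemma fourier_tderiv_on (t0 : R) (d : R -> list Z -> C) (d' : list Z -> C) (t x : R) :
  (forall t, Ico0 t0 t -> bounded_by (d t) v) -> bounded_by d' v -> Ico0 t0 t ->
  (forall n s, length n = nu -> Ico0 t0 s -> Cmod (d s n - d t n) <= Rabs (s - t) * v n) ->
  (forall n, length n = nu ->
     Ctends (within (fun s => Ico0 t0 s /\ s <> t) (locally t))
       (fun s => RtoC (/ (s - t)) * (d s n - d t n))%C (d' n)) ->
  tderiv_on t0 (fun t x => fourier (d t) x) t x (fourier d' x).
Proof.
  intros Hd Hd' Ht Hlip Hc. unfold tderiv_on.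
  apply (Ctends_filterlim (within (fun s => Ico0 t0 s /\ s <> t) (locally t))).
  apply Ctends_ext_loc with (fun s => limsum (boxes nu) (fun n => RtoC (/ (s - t)) *
     (d s n * cexp (zdot n w * x) - d t n * cexp (zdot n w * x)))%C).
  { unfold within. apply filter_forall. intros s [Hs _].
    rewrite <- limsum_quotient by (apply fourier_dominated; apply Hd; assumption).
    symmetry. exact (scal_C_R (/ (s - t)) (fourier (d s) x - fourier (d t) x)%C). }
  apply (limsum_dominated_convergence _ (boxes_exhaustion nu) v S Hv
    (within (fun s => Ico0 t0 s /\ s <> t) (locally t))
    (fun s n => RtoC (/ (s - t)) * (d s n * cexp (zdot n w * x) - d t n * cexp (zdot n w * x)))%C
    (fun n => d' n * cexp (zdot n w * x))%C).
  - unfold within. apply filter_forall. intros s [Hs Hne] N n Hn. apply In_box_length in Hn.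
    replace (d s n * cexp (zdot n w * x) - d t n * cexp (zdot n w * x))%C
      with ((d s n - d t n) * cexp (zdot n w * x))%C by ring.
    assert (Hst : 0 < Rabs (s - t)) by (apply Rabs_pos_lt; lra).
    rewrite !Cmod_mult, Cmod_cexp, Cmod_R, Rabs_inv, Rmult_1_r.
    apply Rmult_le_reg_l with (Rabs (s - t)); [exact Hst|].
    rewrite <- Rmult_assoc, Rinv_r, Rmult_1_l by lra. apply Hlip; assumption.
  - apply fourier_dominated. exact Hd'.
  - intros N n Hn. apply In_box_length in Hn.
    generalize (Ctends_mult _ _ _ _ (Hc n Hn) (Ctends_const (cexp (zdot n w * x)))).
    apply Ctends_ext. intros s. ring.
Qed.

End Fourier.

(** * The limit of the iteration is a classical solution *)

(** Since $1+z\le K e^{\delta z/6}$, the cube costs $e^{\delta z/2}$ and half of the decay is left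
    for summation. The exponent 3 accounts for three derivatives in $x$. *)
Lemma summable_poly_exp (nu : nat) (delta : R) :
  0 < delta ->
  exists S, summable (boxes nu) (fun n => (1 + zl1 n) ^ 3 * exp (- delta * zl1 n)) S.
Proof.
  intros Hd. set (K := 1 + 6 / delta).
  assert (HK : 0 < 6 / delta) by (apply Rdiv_lt_0_compat; lra).
  exists (K ^ 3 * (2 / (delta / 2) + 1) ^ nu).
  apply summable_le with (u := fun n => K ^ 3 * exp (- (delta / 2) * zl1 n)).
  - intros N n _. pose proof (zl1_ge0 n) as Hz. split.
    + apply Rmult_le_pos; [apply pow_le; lra | apply Rlt_le, exp_pos].
    + assert (H1 : 1 + zl1 n <= K * exp (delta / 6 * zl1 n)).
      { apply Rle_trans with (K * (1 + delta / 6 * zl1 n)).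
        - unfold K. replace ((1 + 6 / delta) * (1 + delta / 6 * zl1 n))
            with (1 + zl1 n + 6 / delta + delta / 6 * zl1 n) by (field; lra).
          assert (0 <= delta / 6 * zl1 n) by (apply Rmult_le_pos; lra). lra.
        - apply Rmult_le_compat_l; [unfold K; lra|]. apply exp_ineq1_le. }
      apply Rle_trans with ((K * exp (delta / 6 * zl1 n)) ^ 3 * exp (- delta * zl1 n)).
      * apply Rmult_le_compat_r; [apply Rlt_le, exp_pos|]. apply pow_incr. lra.
      * right. rewrite Rpow_mult_distr, Rmult_assoc. f_equal.
        simpl. rewrite Rmult_1_r, <- !exp_plus. f_equal. field.
  - apply summable_scal; [apply pow_le; unfold K; lra|]. apply summable_exp. lra.
Qed.

Section Solution.
Variables (p nu : nat) (w : list R) (c : list Z -> C).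
Variables (b : list Z -> R) (y0 s t0 delta M : R) (a : R -> list Z -> C).
Hypothesis Hp : (1 <= p)%nat.
Hypothesis Ht0 : 0 < t0.
Hypothesis Hdelta : 0 < delta.
Hypothesis Hwt : forall t, 0 <= t < t0 -> delta <= wt y0 s t.
Hypothesis Hb : summable (boxes nu) b M.
Hypothesis Ha : regular nu y0 s t0 a b.
Hypothesis Hfix : forall t n, 0 <= t < t0 -> length n = nu -> a t n = step p nu w c a t n.

Lemma wt_ge0 (t : R) : 0 <= t < t0 -> 0 <= wt y0 s t.
Proof. intros Ht. pose proof (Hwt t Ht). lra. Qed.

Lemma exp_wt_le (t : R) (n : list Z) :
  0 <= t < t0 -> exp (- wt y0 s t * zl1 n) <= exp (- delta * zl1 n).
Proof.
  intros Ht. pose proof (Hwt t Ht). pose proof (zl1_ge0 n).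
  apply exp_le_compat. nra.
Qed.

Lemma sol_le (t : R) (n : list Z) :
  0 <= t < t0 -> length n = nu -> Cmod (a t n) <= M * exp (- delta * zl1 n).
Proof.
  intros Ht Hn. eapply Rle_trans; [apply (reg_maj _ _ _ _ _ _ Ha t Ht n Hn)|].
  apply Rmult_le_compat.
  - apply (summable_boxes_ge0 nu b M n Hb Hn).
  - apply Rlt_le, exp_pos.
  - apply (summable_boxes_elem nu b M n Hb Hn).
  - apply exp_wt_le. exact Ht.
Qed.

Lemma conv_sol_le (t : R) (n : list Z) :
  0 <= t < t0 -> length n = nu -> Cmod (conv p nu (a t) n) <= M ^ p * exp (- delta * zl1 n).
Proof.
  intros Ht Hn.
  eapply Rle_trans; [apply (conv_le nu p Hp (wt y0 s t) (a t) b M n); auto using wt_ge0;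
                     apply (reg_maj _ _ _ _ _ _ Ha t Ht)|].
  assert (Hr := summable_rconv nu p Hp b M Hb).
  apply Rmult_le_compat.
  - apply (summable_boxes_ge0 nu _ _ n Hr Hn).
  - apply Rlt_le, exp_pos.
  - apply (summable_boxes_elem nu _ _ n Hr Hn).
  - apply exp_wt_le. exact Ht.
Qed.

(** The right-hand side of the ordinary differential equation that a single mode satisfies, $\dot
    a=i(n\cdot\omega)^3a-\frac{i\,n\cdot\omega}{\mathfrak p}a^{*\mathfrak p}$. *)
Definition sol_dt (t : R) (n : list Z) : C :=
  (Ci * RtoC (zdot n w ^ 3) * a t n - Ci * RtoC (zdot n w / INR p) * conv p nu (a t) n)%C.

(* [sol_ext] continues [a] past [t = 0], so that ordinary derivatives are available there. *)
Definition sol_ext (n : list Z) (t : R) : C :=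
  (cexp (zdot n w ^ 3 * t) *
   (c n - Ci * RtoC (zdot n w / INR p) * profile_primitive p nu w a n t))%C.

Lemma sol_ext_eq (t : R) (n : list Z) : 0 <= t < t0 -> length n = nu -> sol_ext n t = a t n.
Proof.
  intros Ht Hn. rewrite (Hfix t n Ht Hn). symmetry.
  apply (step_primitive p nu w c y0 s t0 Hp Ht0 wt_ge0 a b M Hb Ha n t Hn Ht).
Qed.

Lemma sol_ext_Cderiv (t : R) (n : list Z) :
  0 <= t < t0 -> length n = nu -> Cderiv (sol_ext n) t (sol_dt t n).
Proof.
  intros Ht Hn.
  assert (Habs : Rabs t = t) by (apply Rabs_pos_eq; lra).
  assert (Hd := primitive_Cderiv p nu w y0 s t0 Hp Ht0 wt_ge0 a b M Hb Ha n t Hn).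
  rewrite Habs in Hd. specialize (Hd (proj2 Ht)).
  assert (H := Cderiv_mult _ _ _ _ _ (Cderiv_cexp (zdot n w ^ 3) t)
    (Cderiv_minus _ _ _ _ _ (Cderiv_const (c n) t)
      (Cderiv_mult _ _ _ _ _ (Cderiv_const (Ci * RtoC (zdot n w / INR p))%C t) Hd))).
  cbv beta in H.
  replace (sol_dt t n) with
    (Ci * (zdot n w ^ 3)%R * cexp (zdot n w ^ 3 * t) *
      (c n - Ci * (zdot n w / INR p)%R * profile_primitive p nu w a n t) +
      cexp (zdot n w ^ 3 * t) *
      (0 - (0 * profile_primitive p nu w a n t + Ci * (zdot n w / INR p)%R * profile p nu w a n t)))%C;
    [exact H|].
  unfold sol_dt. rewrite <- (sol_ext_eq t n Ht Hn). unfold sol_ext, profile. rewrite Habs.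
  (* The outer phase undoes the phase inside [profile], leaving the bare convolution. *)
  assert (He : (cexp (zdot n w ^ 3 * t) * cexp (- zdot n w ^ 3 * t))%C = 1%C).
  { rewrite <- cexp_plus. replace (zdot n w ^ 3 * t + - zdot n w ^ 3 * t) with 0 by ring.
    apply cexp_0. }
  replace (conv p nu (a t) n) with
    (cexp (zdot n w ^ 3 * t) * cexp (- zdot n w ^ 3 * t) * conv p nu (a t) n)%C at 2
    by (rewrite He; ring).
  ring.
Qed.

Lemma primitive_lipschitz (n : list Z) (t t' : R) :
  length n = nu -> 0 <= t <= t' -> t' < t0 ->
  Cmod (profile_primitive p nu w a n t' - profile_primitive p nu w a n t)
  <= (t' - t) * (M ^ p * exp (- delta * zl1 n)).
Proof.
  intros Hn Ht Ht'.
  assert (Hint : forall tau, 0 <= tau < t0 ->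
    @is_RInt C_R_NormedModule (profile p nu w a n) 0 tau (profile_primitive p nu w a n tau)).
  { intros tau Htau. apply (profile_RInt p nu w y0 s t0 Hp Ht0 wt_ge0 a b M Hb Ha n tau Hn).
    rewrite Rabs_pos_eq; lra. }
  assert (Ht1 : 0 <= t < t0) by lra. assert (Ht2 : 0 <= t' < t0) by lra.
  assert (H := is_RInt_Chasles (V := C_R_NormedModule) _ _ _ _ _ _
    (is_RInt_swap (V := C_R_NormedModule) _ _ _ _ (Hint t Ht1)) (Hint t' Ht2)).
  rewrite <- norm_C_R.
  apply (norm_RInt_le_const (V := C_R_NormedModule) (profile p nu w a n) t t'); [lra| |].
  - intros tau Htau. rewrite norm_C_R. unfold profile.
    rewrite Cmod_mult, Cmod_cexp, Rmult_1_l, Rabs_pos_eq by lra.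
    apply conv_sol_le; [lra | exact Hn].
  - replace (profile_primitive p nu w a n t' - profile_primitive p nu w a n t)%C
      with (@plus C_R_NormedModule (@opp C_R_NormedModule (profile_primitive p nu w a n t))
              (profile_primitive p nu w a n t')); [exact H|].
    change (- profile_primitive p nu w a n t + profile_primitive p nu w a n t' =
            profile_primitive p nu w a n t' - profile_primitive p nu w a n t)%C. ring.
Qed.

Definition freq_bound (n : list Z) : R := (1 + rnorm w) * (1 + zl1 n).

(** One summable majorant for all the series involved: the solution, its three derivatives in $x$,
    its time derivative, the convolution power and its derivative, and the Lipschitz constants in
    time. The cube covers lower powers because [freq_bound] is at least 1; the factor 2 comes from
    [Cmod_cexp_diff]. *)
Definition coef_bound (n : list Z) : R :=
  2 * (M + M ^ p) * (freq_bound n ^ 3 * exp (- delta * zl1 n)).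

Lemma M_ge0 : 0 <= M.
Proof. apply (summable_const_ge0 nu b M Hb). Qed.

Lemma summable_coef_bound : exists S, summable (boxes nu) coef_bound S.
Proof.
  destruct (summable_poly_exp nu delta Hdelta) as [S HS].
  exists (2 * (M + M ^ p) * (1 + rnorm w) ^ 3 * S).
  pose proof M_ge0 as HM. pose proof (pow_le M p HM). pose proof (rnorm_ge0 w).
  assert (HK : 0 <= 2 * (M + M ^ p) * (1 + rnorm w) ^ 3).
  { apply Rmult_le_pos; [lra|]. apply pow_le. lra. }
  apply summable_le with (2 := summable_scal _ _ _ _ HK HS).
  intros N n _. unfold coef_bound, freq_bound. rewrite Rpow_mult_distr. split.
  - pose proof (zl1_ge0 n). repeat apply Rmult_le_pos; try lra.
    apply Rlt_le, exp_pos.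
  - right. ring.
Qed.

Lemma zdot_freq_bound (n : list Z) : Rabs (zdot n w) <= freq_bound n /\ 1 <= freq_bound n.
Proof.
  unfold freq_bound. pose proof (zdot_le n w). pose proof (zl1_ge0 n). pose proof (rnorm_ge0 w).
  assert (0 <= rnorm w * zl1 n) by (apply Rmult_le_pos; assumption).
  split; nra.
Qed.

Lemma zdot_pow_le (n : list Z) (j : nat) :
  (j <= 3)%nat -> Rabs (zdot n w) ^ j <= freq_bound n ^ 3.
Proof.
  intros Hj. destruct (zdot_freq_bound n) as [H1 H2].
  eapply Rle_trans; [apply pow_incr; split; [apply Rabs_pos | exact H1]|].
  apply Rle_pow; assumption.
Qed.

Lemma coef_bound_le (n : list Z) (i j : nat) (z z' : R) :
  (i <= 3)%nat -> (j <= 3)%nat ->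
  0 <= z <= M * exp (- delta * zl1 n) -> 0 <= z' <= M ^ p * exp (- delta * zl1 n) ->
  2 * (Rabs (zdot n w) ^ i * z) + Rabs (zdot n w) ^ j * z' <= coef_bound n.
Proof.
  intros Hi Hj Hz Hz'.
  assert (H1 : Rabs (zdot n w) ^ i * z <= freq_bound n ^ 3 * (M * exp (- delta * zl1 n))).
  { apply Rmult_le_compat; [apply pow_le, Rabs_pos | apply Hz | apply zdot_pow_le; exact Hi | apply Hz]. }
  assert (H2 : Rabs (zdot n w) ^ j * z' <= freq_bound n ^ 3 * (M ^ p * exp (- delta * zl1 n))).
  { apply Rmult_le_compat; [apply pow_le, Rabs_pos | apply Hz' | apply zdot_pow_le; exact Hj | apply Hz']. }
  assert (H3 : 0 <= freq_bound n ^ 3 * (M ^ p * exp (- delta * zl1 n))).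
  { eapply Rle_trans; [|exact H2]. apply Rmult_le_pos; [apply pow_le, Rabs_pos | apply Hz']. }
  unfold coef_bound. lra.
Qed.

Lemma zero_bounds (n : list Z) : 0 <= 0 <= M * exp (- delta * zl1 n) /\
  0 <= 0 <= M ^ p * exp (- delta * zl1 n).
Proof.
  pose proof M_ge0 as HM. pose proof (pow_le M p HM). pose proof (exp_pos (- delta * zl1 n)).
  assert (0 <= M * exp (- delta * zl1 n)) by (apply Rmult_le_pos; lra).
  assert (0 <= M ^ p * exp (- delta * zl1 n)) by (apply Rmult_le_pos; lra). lra.
Qed.

Lemma sol_pow_le (n : list Z) (t : R) (j : nat) :
  (j <= 3)%nat -> 0 <= t < t0 -> length n = nu ->
  Rabs (zdot n w) ^ j * Cmod (a t n) <= coef_bound n.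
Proof.
  intros Hj Ht Hn.
  assert (Hz : 0 <= Cmod (a t n) <= M * exp (- delta * zl1 n))
    by (split; [apply Cmod_ge_0 | apply sol_le; assumption]).
  assert (H := coef_bound_le n j j _ 0 Hj Hj Hz (proj2 (zero_bounds n))).
  pose proof (Rmult_le_pos _ _ (pow_le _ j (Rabs_pos (zdot n w))) (proj1 Hz)). lra.
Qed.

Lemma conv_pow_le (n : list Z) (t : R) (j : nat) :
  (j <= 3)%nat -> 0 <= t < t0 -> length n = nu ->
  Rabs (zdot n w) ^ j * Cmod (conv p nu (a t) n) <= coef_bound n.
Proof.
  intros Hj Ht Hn.
  assert (Hz : 0 <= Cmod (conv p nu (a t) n) <= M ^ p * exp (- delta * zl1 n))
    by (split; [apply Cmod_ge_0 | apply conv_sol_le; assumption]).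
  assert (H := coef_bound_le n j j 0 _ Hj Hj (proj1 (zero_bounds n)) Hz). lra.
Qed.

Lemma Cmod_freq_div (n : list Z) :
  Cmod (Ci * RtoC (zdot n w / INR p)) <= Rabs (zdot n w) ^ 1.
Proof.
  assert (HpR : 1 <= INR p) by (apply (le_INR 1); exact Hp).
  rewrite Cmod_mult, Cmod_Ci, Cmod_R, Rmult_1_l, pow_1. unfold Rdiv. rewrite Rabs_mult.
  rewrite <- (Rmult_1_r (Rabs (zdot n w))) at 2. apply Rmult_le_compat_l; [apply Rabs_pos|].
  rewrite Rabs_pos_eq by (apply Rlt_le, Rinv_0_lt_compat; lra).
  rewrite <- Rinv_1. apply Rinv_le_contravar; lra.
Qed.

Lemma sol_dt_le (n : list Z) (t : R) :
  0 <= t < t0 -> length n = nu -> Cmod (sol_dt t n) <= coef_bound n.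
Proof.
  intros Ht Hn. unfold sol_dt, Cminus. eapply Rle_trans; [apply Cmod_triangle|].
  rewrite Cmod_opp, (Cmod_mult _ (a t n)), (Cmod_mult _ (conv p nu (a t) n)).
  rewrite Cmod_mult, Cmod_Ci, Cmod_R, Rmult_1_l, <- RPow_abs.
  assert (Hz : 0 <= Cmod (a t n) <= M * exp (- delta * zl1 n))
    by (split; [apply Cmod_ge_0 | apply sol_le; assumption]).
  assert (Hz' : 0 <= Cmod (conv p nu (a t) n) <= M ^ p * exp (- delta * zl1 n))
    by (split; [apply Cmod_ge_0 | apply conv_sol_le; assumption]).
  assert (H := coef_bound_le n 3 1 _ _ (le_n 3) ltac:(lia) Hz Hz').
  pose proof (Rmult_le_pos _ _ (pow_le _ 3 (Rabs_pos (zdot n w))) (proj1 Hz)).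
  pose proof (Rmult_le_compat_r _ _ _ (proj1 Hz') (Cmod_freq_div n)). lra.
Qed.

(** The coefficient is a phase times a slowly varying factor [K] of the same modulus. The phase
    contributes $2|n\cdot\omega|^3|a|$ and [K] contributes $|n\cdot\omega|$ times the bound on the
    convolution; [coef_bound] covers both. *)
Lemma sol_lipschitz (n : list Z) (t t' : R) :
  length n = nu -> 0 <= t < t0 -> 0 <= t' < t0 ->
  Cmod (a t' n - a t n) <= Rabs (t' - t) * coef_bound n.
Proof.
  intros Hn.
  assert (Hle : forall t t', 0 <= t <= t' -> t' < t0 ->
    Cmod (a t' n - a t n) <= (t' - t) * coef_bound n).
  { clear t t'. intros t t' Ht Ht'.
    assert (Ht1 : 0 <= t < t0) by lra. assert (Ht2 : 0 <= t' < t0) by lra.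
    set (k := (Ci * RtoC (zdot n w / INR p))%C).
    set (K := fun tau => (c n - k * profile_primitive p nu w a n tau)%C).
    assert (HK : Cmod (K t') = Cmod (a t' n)).
    { rewrite <- (sol_ext_eq t' n Ht2 Hn). unfold sol_ext. fold k. fold (K t').
      rewrite Cmod_mult, Cmod_cexp. ring. }
    rewrite <- (sol_ext_eq t' n Ht2 Hn), <- (sol_ext_eq t n Ht1 Hn). unfold sol_ext.
    fold k. fold (K t'). fold (K t).
    replace (cexp (zdot n w ^ 3 * t') * K t' - cexp (zdot n w ^ 3 * t) * K t)%C
      with ((cexp (zdot n w ^ 3 * t') - cexp (zdot n w ^ 3 * t)) * K t' +
            cexp (zdot n w ^ 3 * t) *
            (- (k * (profile_primitive p nu w a n t' - profile_primitive p nu w a n t))))%C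
      by (unfold K; ring).
    eapply Rle_trans; [apply Cmod_triangle|].
    rewrite (Cmod_mult _ (K t')), (Cmod_mult (cexp _)), Cmod_cexp, Rmult_1_l, Cmod_opp, Cmod_mult, HK.
    assert (H1 := Cmod_cexp_diff (zdot n w ^ 3 * t') (zdot n w ^ 3 * t)).
    rewrite <- Rmult_minus_distr_l, Rabs_mult, (Rabs_pos_eq (t' - t)), <- RPow_abs in H1 by lra.
    assert (Hz : 0 <= Cmod (a t' n) <= M * exp (- delta * zl1 n))
      by (split; [apply Cmod_ge_0 | apply sol_le; assumption]).
    assert (H2 := Rmult_le_compat_r _ _ _ (proj1 Hz) H1).
    set (q := M ^ p * exp (- delta * zl1 n)).
    assert (Hq : 0 <= q) by (destruct (zero_bounds n) as [_ [_ Hq]]; exact Hq).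
    assert (H3 : Cmod k * Cmod (profile_primitive p nu w a n t' - profile_primitive p nu w a n t)
                 <= Rabs (zdot n w) ^ 1 * ((t' - t) * q)).
    { apply Rmult_le_compat; try apply Cmod_ge_0; [apply Cmod_freq_div|].
      apply primitive_lipschitz; assumption. }
    assert (H4 := coef_bound_le n 3 1 _ q (le_n 3) ltac:(lia) Hz (conj Hq (Rle_refl q))).
    apply Rle_trans with ((t' - t) *
      (2 * (Rabs (zdot n w) ^ 3 * Cmod (a t' n)) + Rabs (zdot n w) ^ 1 * q)); [lra|].
    apply Rmult_le_compat_l; lra. }
  intros Ht Ht'. destruct (Rle_dec t t') as [H|H].
  - rewrite (Rabs_pos_eq (t' - t)) by lra. apply Hle; lra.
  - rewrite Rabs_minus_sym, Cmod_minus_sym, (Rabs_pos_eq (t - t')) by lra. apply Hle; lra.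
Qed.

(** * Continuity on the strip and verification of the equation *)

Lemma Ctends_Ico0 (f g : R -> C) (t : R) :
  Ico0 t0 t -> (forall tau, Ico0 t0 tau -> f (Rabs tau) = g tau) ->
  Ctends (locally t) (fun tau => f (Rabs tau)) (f (Rabs t)) ->
  Ctends (within (Ico0 t0) (locally t)) g (g t).
Proof.
  intros Ht Hfg H. rewrite <- (Hfg t Ht).
  apply Ctends_ext_loc with (fun tau => f (Rabs tau)).
  - unfold within. apply filter_forall. exact Hfg.
  - apply (Ctends_filter_le _ (locally t)); [apply filter_le_within | exact H].
Qed.

Lemma sol_continuous (n : list Z) (t : R) :
  length n = nu -> Ico0 t0 t -> Ctends (within (Ico0 t0) (locally t)) (fun tau => a tau n) (a t n).
Proof.
  intros Hn Ht. apply (Ctends_Ico0 (fun tau => a tau n)); [exact Ht| |].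
  - intros tau [Htau _]. rewrite Rabs_pos_eq by exact Htau. reflexivity.
  - apply (reg_cont _ _ _ _ _ _ Ha n t Hn). destruct Ht. rewrite Rabs_pos_eq; assumption.
Qed.

Lemma conv_sol_continuous (n : list Z) (t : R) :
  length n = nu -> Ico0 t0 t ->
  Ctends (within (Ico0 t0) (locally t)) (fun tau => conv p nu (a tau) n) (conv p nu (a t) n).
Proof.
  intros Hn Ht. apply (Ctends_Ico0 (fun tau => conv p nu (a tau) n)); [exact Ht| |].
  - intros tau [Htau _]. rewrite Rabs_pos_eq by exact Htau. reflexivity.
  - apply (conv_continuous p nu y0 s t0 Hp wt_ge0 a b M Hb Ha n t Hn).
    destruct Ht. rewrite Rabs_pos_eq; assumption.
Qed.

Lemma Cmod_dcoef (d : list Z -> C) (n : list Z) :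
  Cmod (dcoef w d n) = Rabs (zdot n w) * Cmod (d n).
Proof. unfold dcoef. rewrite !Cmod_mult, Cmod_Ci, Cmod_R. ring. Qed.

Lemma dcoef_continuous (d : R -> list Z -> C) (n : list Z) (t : R) :
  Ctends (within (Ico0 t0) (locally t)) (fun tau => d tau n) (d t n) ->
  Ctends (within (Ico0 t0) (locally t)) (fun tau => dcoef w (d tau) n) (dcoef w (d t) n).
Proof. apply Ctends_scal. Qed.

Lemma sol_gKdV : gKdV_classical p t0 (fun t x => fourier nu w (a t) x).
Proof.
  destruct summable_coef_bound as [S Hv].
  set (d1 := fun t => dcoef w (a t)). set (d2 := fun t => dcoef w (d1 t)).
  set (d3 := fun t => dcoef w (d2 t)). set (q := fun t => conv p nu (a t)).
  assert (B0 : forall t, Ico0 t0 t -> bounded_by nu (a t) coef_bound).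
  { intros t Ht n Hn. pose proof (sol_pow_le n t 0 ltac:(lia) Ht Hn) as H. simpl in H. lra. }
  assert (B1 : forall t, Ico0 t0 t -> bounded_by nu (d1 t) coef_bound).
  { intros t Ht n Hn. pose proof (sol_pow_le n t 1 ltac:(lia) Ht Hn) as H. unfold d1.
    rewrite Cmod_dcoef. simpl in H. lra. }
  assert (B2 : forall t, Ico0 t0 t -> bounded_by nu (d2 t) coef_bound).
  { intros t Ht n Hn. pose proof (sol_pow_le n t 2 ltac:(lia) Ht Hn) as H. unfold d2, d1.
    rewrite !Cmod_dcoef. simpl in H. lra. }
  assert (B3 : forall t, Ico0 t0 t -> bounded_by nu (d3 t) coef_bound).
  { intros t Ht n Hn. pose proof (sol_pow_le n t 3 ltac:(lia) Ht Hn) as H. unfold d3, d2, d1.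
    rewrite !Cmod_dcoef. simpl in H. lra. }
  assert (Bt : forall t, Ico0 t0 t -> bounded_by nu (sol_dt t) coef_bound).
  { intros t Ht n Hn. apply sol_dt_le; assumption. }
  assert (Bq : forall t, Ico0 t0 t -> bounded_by nu (q t) coef_bound).
  { intros t Ht n Hn. pose proof (conv_pow_le n t 0 ltac:(lia) Ht Hn) as H. simpl in H.
    unfold q. lra. }
  assert (Bq1 : forall t, Ico0 t0 t -> bounded_by nu (dcoef w (q t)) coef_bound).
  { intros t Ht n Hn. pose proof (conv_pow_le n t 1 ltac:(lia) Ht Hn) as H. simpl in H.
    rewrite Cmod_dcoef. unfold q. lra. }
  exists (fun t x => fourier nu w (sol_dt t) x), (fun t x => fourier nu w (d1 t) x),
    (fun t x => fourier nu w (d2 t) x), (fun t x => fourier nu w (d3 t) x).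
  intros t x Ht.
  assert (C0 : forall n, length n = nu ->
    Ctends (within (Ico0 t0) (locally t)) (fun tau => a tau n) (a t n))
    by (intros n Hn; apply sol_continuous; assumption).
  refine (conj _ (conj _ (conj _ (conj _ (conj _ (conj _ (conj _ (conj _ (conj _ _))))))))).
  - apply (fourier_tderiv_on nu w coef_bound S Hv t0 a (sol_dt t) t x B0 (Bt t Ht) Ht).
    + intros n s' Hn Hs'. apply sol_lipschitz; assumption.
    (* Inside $[0,t_0)$ the quotient of [a] is that of [sol_ext], whose two-sided derivative
       restricts to the one-sided limit at [t = 0]. *)
    + intros n Hn. apply Ctends_ext_loc with
        (fun s' => RtoC (/ (s' - t)) * (sol_ext n s' - sol_ext n t))%C.
      * unfold within. apply filter_forall. intros s' [Hs' _].
        rewrite (sol_ext_eq s' n Hs' Hn), (sol_ext_eq t n Ht Hn). reflexivity.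
      * apply (Ctends_filter_le _ (locally' t)); [|apply sol_ext_Cderiv; assumption].
        intros P. unfold locally', within. apply filter_imp. intros y HP [_ Hne]. auto.
  - apply Cderiv_is_derive. apply (fourier_Cderiv nu w coef_bound S Hv); [apply B0 | apply B1]; exact Ht.
  - apply Cderiv_is_derive. apply (fourier_Cderiv nu w coef_bound S Hv); [apply B1 | apply B2]; exact Ht.
  - apply Cderiv_is_derive. apply (fourier_Cderiv nu w coef_bound S Hv); [apply B2 | apply B3]; exact Ht.
  - apply (fourier_cont_on_strip nu w coef_bound S Hv); auto.
  - apply (fourier_cont_on_strip nu w coef_bound S Hv); auto.
    intros n Hn. apply Ctends_minus; apply Ctends_scal;
      [apply C0; exact Hn | apply conv_sol_continuous; assumption].
  - apply (fourier_cont_on_strip nu w coef_bound S Hv); auto.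
    intros n Hn. unfold d1. repeat apply dcoef_continuous. auto.
  - apply (fourier_cont_on_strip nu w coef_bound S Hv); auto.
    intros n Hn. unfold d2, d1. repeat apply dcoef_continuous. auto.
  - apply (fourier_cont_on_strip nu w coef_bound S Hv); auto.
    intros n Hn. unfold d3, d2, d1. repeat apply dcoef_continuous. auto.
  - assert (Hpow : forall y, fourier nu w (q t) y = Defs.Cpow (fourier nu w (a t) y) p).
    { intros y.
      assert (Hmaj : majorized nu 0 (a t) b).
      { apply (majorized_weaken nu (wt y0 s t) _ b M); auto.
        - apply wt_ge0. exact Ht.
        - apply (reg_maj _ _ _ _ _ _ Ha t Ht). }
      unfold fourier.
      rewrite <- (limsum_conv nu p Hp (fun n => a t n * cexp (zdot n w * y))%C b M Hb).
      - apply limsum_ext. intros N n Hn. symmetry.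
        apply (conv_modulate nu p Hp (a t) b M w y n Hb Hmaj). apply (In_box_length _ _ _ Hn).
      - intros n Hn. rewrite Cmod_mult, Cmod_cexp, Rmult_1_r. apply Hmaj. exact Hn. }
    (* The same function of $x$ is differentiated termwise and by the power rule; uniqueness of the
       derivative equates the results. *)
    assert (Hd : fourier nu w (dcoef w (q t)) x =
                 (RtoC (INR p) * Defs.Cpow (fourier nu w (a t) x) (p - 1) * fourier nu w (d1 t) x)%C).
    { apply (Cderiv_unique (fourier nu w (q t)) x).
      - apply (fourier_Cderiv nu w coef_bound S Hv); auto.
      - apply Cderiv_ext with (fun y => Defs.Cpow (fourier nu w (a t) y) p);
          [intros y; symmetry; apply Hpow|].
        apply Cderiv_Cpow. apply (fourier_Cderiv nu w coef_bound S Hv); [apply B0 | apply B1]; exact Ht. }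
    assert (HpR : INR p <> 0) by (apply not_0_INR; lia).
    rewrite <- (fourier_plus nu w coef_bound S Hv) by auto.
    (* As $(i\theta)^3=-i\theta^3$ with $\theta=n\cdot\omega$, the linear parts of the time
       derivative and of the third space derivative cancel, leaving $-1/\mathfrak p$ times the
       coefficients of $\partial_x(u^{\mathfrak p})$. *)
    rewrite (fourier_ext nu w _ (fun n => RtoC (- / INR p) * dcoef w (q t) n)%C).
    + rewrite (fourier_scal nu w coef_bound S Hv) by auto. rewrite Hd.
      rewrite RtoC_opp.
      assert (Hi : (RtoC (INR p) * RtoC (/ INR p))%C = 1%C) by (apply RtoC_mult_inv; exact HpR).
      transitivity ((1 - RtoC (INR p) * RtoC (/ INR p)) *
        (Defs.Cpow (fourier nu w (a t) x) (p - 1) * fourier nu w (d1 t) x))%C; [ring|].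
      rewrite Hi. ring.
    + intros n Hn. unfold sol_dt, d3, d2, d1, dcoef, q, Rdiv.
      rewrite RtoC_opp, RtoC_mult, !RtoC_pow.
      transitivity (Ci * RtoC (zdot n w) * RtoC (zdot n w) * RtoC (zdot n w) * a t n * (1 + Ci * Ci)
        - Ci * RtoC (zdot n w) * RtoC (/ INR p) * conv p nu (a t) n)%C; [simpl; ring|].
      replace (Ci * Ci)%C with (- (1))%C by (unfold Ci, Cmult, Copp; simpl; f_equal; ring).
      ring.
Qed.

Lemma sol_initial (n : list Z) : length n = nu -> a 0 n = c n.
Proof.
  intros Hn. rewrite (Hfix 0 n (conj (Rle_refl 0) Ht0) Hn). unfold step, duhamel.
  rewrite (RInt_point (V := C_R_CompleteNormedModule)), Rmult_0_r, cexp_0.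
  change (@zero C_R_CompleteNormedModule) with (RtoC 0). ring.
Qed.

End Solution.

(** * The choice of constants and the conclusion *)

Lemma weight_loss_le (p nu : nat) (kappa Box W t : R) :
  (2 <= p)%nat -> 0 < kappa -> kappa <= 1 -> 0 < Box -> 0 < W ->
  t < kappa ^ ((p - 1) * nu + 1)
      / (2 * INR (p - 1) * exp 1 * Box ^ (p - 1) * 12 ^ ((p - 1) * nu + 1) * W) ->
  W * Box ^ (p - 1) * t <= kappa / 10.
Proof.
  intros Hp Hk Hk1 HB HW Ht. set (m := ((p - 1) * nu)%nat) in *.
  assert (HBp : 0 < Box ^ (p - 1)) by (apply pow_lt; exact HB).
  assert (HpR : 1 <= INR (p - 1)) by (apply (le_INR 1); lia).
  assert (He : 1 <= exp 1) by (pose proof (exp_ineq1_le 1); lra).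
  assert (H12 : 1 <= 12 ^ m) by (apply pow_R1_Rle; lra).
  assert (Hkm : 0 <= kappa ^ m <= 1).
  { split; [apply pow_le; lra|]. rewrite <- (pow1 m). apply pow_incr. lra. }
  (* The factor [W * Box ^ (p - 1)] cancels against the time bound and leaves [kappa ^ (m + 1) / D].
     From [D >= 24] and [kappa ^ m <= 1] this is at most [kappa / 24], within the allowance
     [kappa / 10]. *)
  set (D := 2 * INR (p - 1) * exp 1 * 12 ^ (m + 1)).
  assert (HD : 24 <= D).
  { unfold D. rewrite pow_add, pow_1.
    assert (1 <= INR (p - 1) * exp 1) by nra. nra. }
  apply Rle_trans with (W * Box ^ (p - 1) *
    (kappa ^ (m + 1) / (2 * INR (p - 1) * exp 1 * Box ^ (p - 1) * 12 ^ (m + 1) * W))).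
  - apply Rmult_le_compat_l; [apply Rmult_le_pos; lra | lra].
  - replace (2 * INR (p - 1) * exp 1 * Box ^ (p - 1) * 12 ^ (m + 1) * W)
      with (D * (Box ^ (p - 1) * W)) by (unfold D; ring).
    replace (W * Box ^ (p - 1) * (kappa ^ (m + 1) / (D * (Box ^ (p - 1) * W))))
      with (kappa ^ (m + 1) / D) by (field; repeat split; lra).
    apply Rmult_le_reg_r with D; [lra|].
    unfold Rdiv at 1. rewrite Rmult_assoc, Rinv_l, Rmult_1_r by lra.
    rewrite pow_add, pow_1. nra.
Qed.

Theorem theorem1 (p nu : nat) (w : list R) (c : list Z -> C) (A kappa : R) :
  (2 <= p)%nat -> (1 <= nu)%nat -> length w = nu -> rat_indep nu w ->
  0 < A -> 0 < kappa -> kappa <= 1 ->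
  (forall n : list Z, length n = nu ->
     Cmod (c n) <= Rpower A (/ INR (p - 1)) * exp (- kappa * zl1 n)) ->
  let u0 := fun x : R => zsum nu (fun n => Cmult (c n) (cexp (zdot n w * x))) in
  let Box := 2 * (6 / kappa) ^ nu * Rpower A (/ INR (p - 1)) in
  let t0 := Rmin
      (kappa ^ ((p - 1) * nu + 1)
         / (2 ^ (p + 1) * 6 ^ ((p - 1) * nu + 1) * A * rnorm w))
      (kappa ^ ((p - 1) * nu + 1)
         / (2 * INR (p - 1) * exp 1 * Box ^ (p - 1) * 12 ^ ((p - 1) * nu + 1)
            * rnorm w)) in
  0 < t0 /\
  exists cd : R -> list Z -> C,
    (forall t n, 0 <= t < t0 -> length n = nu ->
       Cmod (cd t n) <= Box * exp (- (kappa / 2) * zl1 n)) /\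
    (forall t n, 0 <= t < t0 -> length n = nu ->
       exists I : C,
         is_RInt (fun tau => Cmult (cexp ((zdot n w) ^ 3 * (t - tau)))
                               (conv p nu (cd tau) n)) 0 t I /\
         cd t n = Cminus (Cmult (cexp ((zdot n w) ^ 3 * t)) (c n))
                         (Cmult (Cmult Ci (RtoC (zdot n w / INR p))) I)) /\
    (let ud := fun t x : R => zsum nu (fun n => Cmult (cd t n) (cexp (zdot n w * x))) in
     gKdV_classical p t0 ud /\ (forall x, ud 0 x = u0 x)) /\
    (forall t n, 0 <= t < t0 -> length n = nu ->
       filterlim (fun k => picard p nu w c k t n) eventually (locally (cd t n))).
Proof.
  intros Hp Hnu Hw Hind HA Hk Hk1 Hc u0 Box t0.
  assert (Hp1 : (1 <= p)%nat) by lia.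
  pose proof (rnorm_pos nu w Hnu Hw Hind) as HW.
  set (B0 := Rpower A (/ INR (p - 1))) in *.
  assert (HB0 : 0 < B0) by apply exp_pos.
  assert (H6 : 0 < (6 / kappa) ^ nu) by (apply pow_lt, Rdiv_lt_0_compat; lra).
  assert (HBox : 0 < Box) by (unfold Box; apply Rmult_lt_0_compat; lra).
  assert (HBp : 0 < Box ^ (p - 1)) by (apply pow_lt; exact HBox).
  assert (HpR : 2 <= INR p) by (apply (le_INR 2); exact Hp).
  assert (Hpm : 0 < INR (p - 1)) by (apply lt_0_INR; lia).
  assert (Ht0 : 0 < t0).
  { unfold t0. apply Rmin_pos; apply Rdiv_lt_0_compat; try (apply pow_lt; lra);
      repeat apply Rmult_lt_0_compat; try (apply pow_lt; lra); try apply exp_pos; lra. }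
  split; [exact Ht0|].
  set (s := rnorm w * Box ^ (p - 1)).
  (* With this value [INR p * lam * s] is exactly [rnorm w]. *)
  set (lam := / (INR p * Box ^ (p - 1))).
  (* The decay rate [kappa] is split: [2 * kappa / 5] is spent in [b0] on summability,
     [3 * kappa / 5] is the initial weight, and a loss of at most [kappa / 10] leaves the required
     [kappa / 2]. *)
  set (y0 := 3 * kappa / 5).
  set (b0 := fun n => B0 * exp (- (2 * kappa / 5) * zl1 n)).
  assert (Hlam : 0 < lam) by (apply Rinv_0_lt_compat, Rmult_lt_0_compat; lra).
  assert (Hs : rnorm w <= INR p * lam * s) by (right; unfold lam, s; field; lra).
  assert (Hs0 : 0 <= s) by (apply Rmult_le_pos; lra).
  assert (Hdelta : forall t, 0 <= t < t0 -> kappa / 2 <= wt y0 s t).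
  { intros t Ht.
    assert (Hl : s * t <= kappa / 10).
    { apply (weight_loss_le p nu); auto. apply Rlt_le_trans with t0; [apply Ht | apply Rmin_r]. }
    unfold wt, y0. lra. }
  assert (Hwt : forall t, 0 <= t < t0 -> 0 <= wt y0 s t)
    by (intros t Ht; pose proof (Hdelta t Ht); lra).
  (* At rate [2 * kappa / 5] the geometric bound is $(5/\kappa+1)^\nu\le(6/\kappa)^\nu$ because
     $\kappa\le1$; times [B0] the right side is half of [Box]. *)
  assert (Hb0 : summable (boxes nu) b0 (Box / 2)).
  { assert (Hr : 0 < 2 * kappa / 5) by lra.
    destruct (summable_scal _ _ _ B0 (Rlt_le _ _ HB0) (summable_exp nu _ Hr)) as [H1 H2].
    split; [exact H1|]. intros N. eapply Rle_trans; [apply H2|].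
    replace (Box / 2) with (B0 * (6 / kappa) ^ nu) by (unfold Box; field; lra).
    apply Rmult_le_compat_l; [lra|]. apply pow_incr.
    assert (H5 : 0 < / kappa) by (apply Rinv_0_lt_compat; lra).
    assert (H7 : 1 <= / kappa) by (rewrite <- Rinv_1; apply Rinv_le_contravar; lra).
    replace (2 / (2 * kappa / 5)) with (5 * / kappa) by (field; lra). unfold Rdiv. lra. }
  assert (Hcm : majorized nu y0 c b0).
  { intros n Hn. eapply Rle_trans; [apply Hc; exact Hn|]. right. unfold b0, y0.
    rewrite Rmult_assoc, <- exp_plus. f_equal. f_equal. field. }
  (* Here $\lambda\Box^{\mathfrak p}=\Box/\mathfrak p$, and $\mathfrak p\ge2$ makes it fit into the
     other half of [Box]. *)
  assert (HM : Box / 2 + lam * Box ^ p <= Box).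
  { rewrite <- (pow_p p Hp1 Box). unfold lam.
    replace (/ (INR p * Box ^ (p - 1)) * (Box * Box ^ (p - 1))) with (Box * / INR p) by (field; lra).
    assert (/ INR p <= / 2) by (apply Rinv_le_contravar; lra). nra. }
  assert (HSM : Box / 2 <= Box) by lra.
  pose proof (Rlt_le _ _ Hlam) as Hlam'.
  assert (Hsum := summable_majorant_lim p nu w c b0 y0 s t0 lam (Box / 2) Box
    Hp1 Ht0 Hlam' Hs Hwt Hs0 Hb0 Hcm HM HSM).
  assert (Hreg := sol_regular p nu w c b0 y0 s t0 lam (Box / 2) Box
    Hp1 Ht0 Hlam' Hs Hwt Hs0 Hb0 Hcm HM HSM).
  assert (Hfix := sol_fixed_point p nu w c b0 y0 s t0 lam (Box / 2) Box
    Hp1 Ht0 Hlam' Hs Hwt Hs0 Hb0 Hcm HM HSM).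
  assert (Hk2 : 0 < kappa / 2) by lra.
  exists (sol p nu w c). split; [|split; [|split]].
  - intros t n Ht Hn.
    apply (sol_le nu _ y0 s t0 (kappa / 2) Box _ Hdelta Hsum Hreg t n Ht Hn).
  - intros t n Ht Hn. exists (duhamel p nu w (sol p nu w c) t n). split.
    + apply (duhamel_correct p nu w y0 s t0 Hp1 Ht0 Hwt _ _ Box Hsum Hreg n t Hn Ht).
    + apply Hfix; assumption.
  (* [zsum] and [limsum] over [boxes] unfold to the same expression, so [ud] is [fourier] of the
     limit coefficients by conversion. *)
  - intros ud. split.
    + apply (sol_gKdV p nu w c _ y0 s t0 (kappa / 2) Box (sol p nu w c)
               Hp1 Ht0 Hk2 Hdelta Hsum Hreg Hfix).
    + intros x. apply (fourier_ext nu w). intros n Hn.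
      apply (sol_initial p nu w c t0 _ Ht0 Hfix n Hn).
  - intros t n Ht Hn. apply (Ctends_filterlim eventually).
    apply (iter_tends p nu w c b0 y0 s t0 lam (Box / 2) Box
      Hp1 Ht0 Hlam' Hs Hwt Hs0 Hb0 Hcm HM HSM t n Ht Hn).
Qed.
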